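(* Let $X$ be a separable metric space and let $\mathcal{U}$ be a uniformly bounded open cover of $X$. Then the Vietoris metric thickening $\mathcal{V}^{\mathrm{m}}(\mathcal{U})$ and the Vietoris simplicial complex $\mathcal{V}(\mathcal{U})$ have isomorphic homotopy groups, $\pi_k(\mathcal{V}^{\mathrm{m}}(\mathcal{U}))\cong \pi_k(\mathcal{V}(\mathcal{U}))$, in all dimensions $k\ge 0$.
   Context: A cover $\mathcal{U}=\{U_\alpha\}_{\alpha\in\mathcal{I}}$ of a metric space $(X,d)$ is a family of nonempty subsets of $X$, indexed by an arbitrary set $\mathcal{I}$ (repetitions allowed), whose union is $X$. It is open if each $U_\alpha$ is open in $X$, and uniformly bounded if there is a constant $D<\infty$ with $\mathrm{diam}(U)<D$ for each $U\in\mathcal{U}$. The Vietoris simplicial complex $\mathcal{V}(\mathcal{U})$ has vertex set $X$, and a finite subset $\sigma\subseteq X$ is a simplex if there is some $U\in\mathcal{U}$ with $\sigma\subseteq U$. Its homotopy groups are those of its geometric realization with the usual (weak) simplicial complex topology. Let $\mathcal{P}^{\mathrm{fin}}(X)$ be the set of finitely supported probability measures $\mu=\sum_{i=0}^k a_i\delta_{x_i}$ on $X$ (with $a_i>0$, $\sum_i a_i=1$, $x_i\in X$ distinct), with $\mathrm{supp}(\mu)=\{x_0,\dots,x_k\}$. The 1-Wasserstein distance between $\mu=\sum_i a_i\delta_{x_i}$ and $\nu=\sum_j b_j\delta_{y_j}$ is $d_W(\mu,\nu)=\inf \sum_{i,j}c_{i,j}\,d(x_i,y_j)$, the infimum being over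 all couplings, i.e. collections of real numbers $c_{i,j}\ge 0$ with $\sum_j c_{i,j}=a_i$ for all $i$ and $\sum_i c_{i,j}=b_j$ for all $j$. The Vietoris metric thickening is the metric space $\mathcal{V}^{\mathrm{m}}(\mathcal{U})=\{\mu\in\mathcal{P}^{\mathrm{fin}}(X) : \mathrm{supp}(\mu)\subseteq U \text{ for some } U\in\mathcal{U}\}$ equipped with $d_W$. Convention: for topological spaces $Y,Y'$, ''$\pi_k(Y)\cong\pi_k(Y')$ for all integers $k\ge 0$'' means that $Y$ and $Y'$ have the same number (cardinality) of path components, and that one can choose one point in each path component of $Y$ and one point in each path component of $Y'$, together with a bijection $h$ from the chosen points of $Y$ to the chosen points of $Y'$, such that $\pi_k(Y,y)\cong\pi_k(Y',h(y))$ for every chosen point $y$ and every integer $k\ge 0$. (No map $Y\to Y'$ inducing these isomorphisms is required.) *)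

(* Defs.v *)
From HB Require Import structures.
From mathcomp Require Import all_boot all_order all_algebra finmap generic_quotient.
From mathcomp Require Import all_classical all_reals all_analysis.
From mathcomp Require Import ring lra.

Set Implicit Arguments.
Unset Strict Implicit.
Unset Printing Implicit Defensive.

Import Order.TTheory GRing.Theory Num.Theory.
Import numFieldNormedType.Exports.

Local Open Scope classical_set_scope.
Local Open Scope ring_scope.

Section FinitelySupportedProbability.
Variables (R : realType) (V : choiceType).

(* The measure \sum_i a_i \delta_{x_i} is encoded by its mass function. *)
Record finprob := FinProb {
  mass :> {fsfun V -> R with 0};
  mass_ge0 : forall v, 0 <= mass v;
  mass_sum1 : \sum_(v <- finsupp mass) mass v = 1 }.

HB.instance Definition _ := gen_eqMixin finprob.
HB.instance Definition _ := gen_choiceMixin finprob.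

Lemma finprobP (mu nu : finprob) : mass mu =1 mass nu -> mu = nu.
Proof.
move=> /fsfunP; case: mu nu => [m m0 m1] [n n0 n1] /= e.
move: m0 m1; rewrite e => m0 m1.
by congr FinProb; exact: Prop_irrelevance.
Qed.

Lemma mass_sumT (mu : finprob) : \sum_(v : finsupp mu) mu (val v) = 1.
Proof. by rewrite -(big_seq_fsetE _ _ predT) /= mass_sum1. Qed.

Lemma mass_gt0 (mu : finprob) (v : finsupp mu) : 0 < mu (val v).
Proof. by rewrite lt_def mass_ge0 -mem_finsupp fsvalP. Qed.

End FinitelySupportedProbability.

Section Wasserstein.
Variables (R : realType) (X : metricType R).
Implicit Types mu nu la : finprob R X.

Definition coupling mu nu : set (finsupp mu -> finsupp nu -> R) :=
  [set c | [/\ forall x y, 0 <= c x y,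
               forall x, \sum_y c x y = mu (val x) &
               forall y, \sum_x c x y = nu (val y)]].

Definition transport_cost mu nu (c : finsupp mu -> finsupp nu -> R) : R :=
  \sum_x \sum_y c x y * mdist (val x) (val y).

Definition wasserstein mu nu : R :=
  inf [set transport_cost c | c in @coupling mu nu].

Lemma transport_cost_ge0 mu nu c : @coupling mu nu c -> 0 <= transport_cost c.
Proof.
case=> c0 _ _; apply: sumr_ge0 => x _; apply: sumr_ge0 => y _.
by rewrite mulr_ge0 // mdist_ge0.
Qed.

Lemma wasserstein_le mu nu c :
  @coupling mu nu c -> wasserstein mu nu <= transport_cost c.
Proof.
move=> cc; apply: ge_inf; last by exists c.
by exists 0 => _ [c' /transport_cost_ge0 ? <-].
Qed.

Lemma coupling_neq0 mu nu :
  [set transport_cost c | c in @coupling mu nu] !=set0.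
Proof.
apply: image_nonempty; exists (fun x y => mu (val x) * nu (val y)); split.
- by move=> x y; rewrite mulr_ge0 ?mass_ge0.
- by move=> x; rewrite -mulr_sumr mass_sumT mulr1.
- by move=> y; rewrite -mulr_suml mass_sumT mul1r.
Qed.

Lemma le_wasserstein mu nu r :
  (forall c, @coupling mu nu c -> r <= transport_cost c) ->
  r <= wasserstein mu nu.
Proof.
move=> rc; apply: lb_le_inf; first exact: coupling_neq0.
by move=> _ [c /rc ? <-].
Qed.

Lemma wasserstein_adherent mu nu e : 0 < e ->
  exists2 c, @coupling mu nu c & transport_cost c < wasserstein mu nu + e.
Proof.
move=> e0; have [|_ [c cc <-] ?] := @inf_adherent _
    [set transport_cost c | c in @coupling mu nu] _ e0; last by exists c.
split; first exact: coupling_neq0.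
by exists 0 => _ [c' /transport_cost_ge0 ? <-].
Qed.

Lemma wasserstein_ge0 mu nu : 0 <= wasserstein mu nu.
Proof. by apply: le_wasserstein => c; exact: transport_cost_ge0. Qed.

Lemma wassersteinxx mu : wasserstein mu mu = 0.
Proof.
apply/eqP; rewrite eq_le wasserstein_ge0 andbT.
pose c (x y : finsupp mu) : R := if x == y then mu (val x) else 0.
have cc : coupling c.
  split=> [x y|x|y].
  - by rewrite /c; case: eqP => // _; rewrite mass_ge0.
  - by rewrite /c -big_mkcond (big_pred1 x) // => y; rewrite eq_sym.
  - by rewrite /c -big_mkcond (big_pred1 y).
apply: (le_trans (wasserstein_le cc)).
rewrite /transport_cost big1 // => x _; rewrite big1 // => y _.
by rewrite /c; case: eqP => [->|_]; rewrite ?mdistxx ?mulr0 ?mul0r.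
Qed.

Lemma wasserstein_sym_le mu nu : wasserstein nu mu <= wasserstein mu nu.
Proof.
apply: le_wasserstein => c [c0 c1 c2].
have cc : @coupling nu mu (fun y x => c x y) by split.
apply: (le_trans (wasserstein_le cc)).
rewrite /transport_cost exchange_big /=.
apply: ler_sum => x _; apply: ler_sum => y _.
by rewrite metric_sym.
Qed.

Lemma wasserstein_sym mu nu : wasserstein mu nu = wasserstein nu mu.
Proof. by apply/eqP; rewrite eq_le !wasserstein_sym_le. Qed.

Lemma wasserstein_eq0_le mu nu (v : X) : wasserstein mu nu = 0 -> mu v <= nu v.
Proof.
move=> d0; have [vmu|/fsfun_dflt -> /=] := boolP (v \in finsupp mu);
  last exact: mass_ge0.
pose e : R := \big[Num.min/1]_(y : finsupp nu | val y != v) mdist v (val y).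
have e_gt0 : 0 < e.
  apply: lt_bigmin => // y yv; rewrite mdist_gt0 eq_sym //.
rewrite -subr_le0 -(pmulr_lle0 _ e_gt0).
suff : (mu v - nu v) * e <= wasserstein mu nu by rewrite [X in _ <= X -> _]d0.
apply: le_wasserstein => c [c0 c1 c2].
pose x0 : finsupp mu := [` vmu]%fset.
have -> : mu v = \sum_y c x0 y by rewrite c1.
rewrite mulrC.
rewrite /transport_cost (bigD1 x0) //= -[leLHS]addr0 lerD //; last first.
  by apply: sumr_ge0 => x _; apply: sumr_ge0 => y _; rewrite mulr_ge0 ?mdist_ge0.
have le_nu : \sum_(y : finsupp nu | val y == v) c x0 y <= nu v.
  have [vnu|vnu] := boolP (v \in finsupp nu).
    rewrite (big_pred1 ([` vnu]%fset)); last first.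
      by move=> y /=; rewrite -val_eqE.
    have -> : nu v = \sum_x c x [` vnu]%fset by rewrite c2.
    rewrite (bigD1 x0) //= lerDl.
    exact: sumr_ge0.
  rewrite big_pred0 ?mass_ge0 // => y; apply/negP => /eqP yv.
  by move: vnu; rewrite -yv (valP y).
rewrite (bigID (fun y => val y == v)) /=.
apply: (@le_trans _ _ (e * \sum_(y : finsupp nu | val y != v) c x0 y)).
  rewrite ler_pM2l // lerBlDr addrC lerD2l //.
rewrite mulr_sumr [leRHS](bigID (fun y => val y == v)) /= -[leLHS]add0r lerD //.
  by apply: sumr_ge0 => y _; rewrite mulr_ge0 ?mdist_ge0.
apply: ler_sum => y yv; rewrite mulrC ler_wpM2l //.
exact: bigmin_le_cond.
Qed.

Lemma wasserstein_eq0 mu nu : wasserstein mu nu = 0 -> mu = nu.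
Proof.
move=> d0; apply: finprobP => v; apply/eqP; rewrite eq_le.
by rewrite !wasserstein_eq0_le // wasserstein_sym.
Qed.

Lemma wasserstein_triangle nu mu la :
  wasserstein mu la <= wasserstein mu nu + wasserstein nu la.
Proof.
apply/ler_addgt0Pl => e e0; have e20 : 0 < e / 2 by rewrite divr_gt0.
have [c [c0 c1 c2] cd] := wasserstein_adherent mu nu e20.
have [b [b0 b1 b2] bd] := wasserstein_adherent nu la e20.
pose g x z := \sum_y c x y * b y z / nu (val y).
have nu0 (y : finsupp nu) : nu (val y) != 0 by rewrite gt_eqF ?mass_gt0.
have gg : @coupling mu la g.
  split=> [x z|x|z].
  - apply: sumr_ge0 => y _; rewrite divr_ge0 ?mass_ge0 //.
    by rewrite mulr_ge0.
  - rewrite exchange_big -c1 /=; apply: eq_bigr => y _.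
    by rewrite -mulr_suml -mulr_sumr b1 mulfK.
  - rewrite exchange_big -b2 /=; apply: eq_bigr => y _.
    by rewrite -!mulr_suml c2 mulrAC divff // mul1r.
apply: (le_trans (wasserstein_le gg)).
apply: (@le_trans _ _ (transport_cost c + transport_cost b)); last lra.
have -> : transport_cost c = \sum_x \sum_z \sum_y
    (c x y * b y z / nu (val y)) * mdist (val x) (val y).
  apply: eq_bigr => x _; rewrite exchange_big; apply: eq_bigr => y _ /=.
  by rewrite -!mulr_suml -mulr_sumr b1 mulfK.
have -> : transport_cost b = \sum_x \sum_z \sum_y
    (c x y * b y z / nu (val y)) * mdist (val y) (val z).
  rewrite /transport_cost exchange_big [RHS]exchange_big /=.
  apply: eq_bigr => z _; rewrite [RHS]exchange_big; apply: eq_bigr => y _ /=.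
  by rewrite -!mulr_suml c2; congr (_ * _); rewrite mulrAC divff ?mul1r.
rewrite -big_split; apply: ler_sum => x _ /=.
rewrite -big_split; apply: ler_sum => z _ /=.
rewrite -big_split /g mulr_suml; apply: ler_sum => y _ /=.
rewrite -mulrDr ler_wpM2l ?metric_triangle //.
by rewrite divr_ge0 ?mass_ge0 // mulr_ge0.
Qed.

HB.instance Definition _ := isMetric.Build R (finprob R X)
  wassersteinxx wasserstein_eq0 wasserstein_sym wasserstein_triangle.

End Wasserstein.

Section SubMetric.
Variables (R : realType) (M : metricType R) (A : set M).

Let sub_mdist (x y : set_type A) : R := mdist (set_val x) (set_val y).

Let sub_mdist_ge0 x y : 0 <= sub_mdist x y. Proof. exact: mdist_ge0. Qed.

Let sub_mdist_positivity x y : sub_mdist x y = 0 -> x = y.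
Proof. by move=> /mdist_positivity; exact: val_inj. Qed.

Let sub_ballEmdist x d : ball x d = [set y | sub_mdist x y < d].
Proof.
rewrite -[LHS]/(set_val @^-1` (ball (set_val x) d)) ballEmdist.
by [].
Qed.

HB.instance Definition _ := PseudoMetric_isMetric.Build R (set_type A)
  sub_mdist_ge0 sub_mdist_positivity sub_ballEmdist.

End SubMetric.

Section SimplicialComplexes.
Variables (R : realType) (V : choiceType).

Record simplicial_complex := SimplicialComplex {
  simplex : set {fset V};
  simplex_neq0 : forall s, simplex s -> s != fset0;
  simplex_sub : forall s t,
    simplex s -> (t `<=` s)%fset -> t != fset0 -> simplex t }.

(* A point of the realization is given by its barycentric coordinates. *)
Record realization (K : simplicial_complex) := Realization {
  bary :> finprob R V;
  bary_simplex : simplex K (finsupp bary) }.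

Variable K : simplicial_complex.

HB.instance Definition _ := gen_eqMixin (realization K).
HB.instance Definition _ := gen_choiceMixin (realization K).

Definition closed_face (s : {fset V}) : set (realization K) :=
  [set p | (finsupp p `<=` s)%fset].

Definition face_coords (s : {fset V}) (p : realization K) : {ptws s -> R} :=
  fun v => p (val v).
Arguments face_coords : clear implicits.

(* The weak topology: the trace of A on each closed simplex is open for the
   Euclidean topology of that simplex. *)
Definition weak_open (A : set (realization K)) : Prop :=
  forall s, simplex K s -> exists2 W : set {ptws s -> R}, open W &
    closed_face s `&` A = closed_face s `&` face_coords s @^-1` W.

Let weak_openT : weak_open setT.
Proof. by move=> s _; exists setT; [exact: openT|rewrite preimage_setT]. Qed.

Let weak_openI : setI_closed weak_open.
Proof.
move=> A B Ao Bo s Ks; have [W Wo AW] := Ao s Ks; have [W' Wo' BW] := Bo s Ks.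
exists (W `&` W'); first exact: openI.
by rewrite preimage_setI -[in LHS](setIid (closed_face s)) setIACA AW BW -setIACA
  setIid.
Qed.

Let weak_open_bigU (J : Type) (F : J -> set (realization K)) :
  (forall j, weak_open (F j)) -> weak_open (\bigcup_j F j).
Proof.
move=> Fo s Ks; exists (\bigcup_(W in [set W : set {ptws s -> R} | open W /\
    closed_face s `&` face_coords s @^-1` W `<=` \bigcup_j F j]) W).
  by apply: bigcup_open => W [].
apply/seteqP; split=> p [sp].
- move=> [j _ Fjp]; split=> //; have [W Wo FW] := Fo j s Ks.
  have Wp : (closed_face s `&` face_coords s @^-1` W) p by rewrite -FW.
  exists W => /=; last by case: Wp.
  by split=> // q; rewrite -FW => -[_ ?]; exists j.
- by move=> [W [Wo WF] Wp]; split=> //; exact: WF.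
Qed.

HB.instance Definition _ := isOpenTopological.Build (realization K)
  weak_openT weak_openI weak_open_bigU.

End SimplicialComplexes.

Section Covers.
Variables (R : realType) (X : metricType R) (I : Type).
Implicit Type U : I -> set X.

Definition diam (A : set X) : \bar R :=
  ereal_sup [set (mdist x y)%:E | x in A & y in A].

Definition is_cover U : Prop :=
  (forall i, U i !=set0) /\ \bigcup_i U i = [set: X].

Definition open_cover U : Prop := is_cover U /\ forall i, open (U i).

Definition uniformly_bounded U : Prop :=
  exists D : R, forall i, (diam (U i) < D%:E)%E.

Definition vietoris_simplex U : set {fset X} :=
  [set s | s != fset0 /\ exists i, [set` s] `<=` U i].

Let vietoris_neq0 U s : vietoris_simplex U s -> s != fset0.
Proof. by case. Qed.

Let vietoris_sub U s t : vietoris_simplex U s ->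
  (t `<=` s)%fset -> t != fset0 -> vietoris_simplex U t.
Proof.
move=> [_ [i sU]] /fsubsetP ts t0; split=> //; exists i.
by move=> x /= /ts; exact: sU.
Qed.

Definition vietoris_complex U : simplicial_complex X :=
  SimplicialComplex (@vietoris_neq0 U) (@vietoris_sub U).

Definition vietoris_thickening U : set (finprob R X) :=
  [set mu | exists i, [set` finsupp mu] `<=` U i].

End Covers.

Definition separable (T : topologicalType) : Prop :=
  exists2 S : set T, countable S & dense S.

Section HomotopyGroups.
Variable R : realType.

Definition cube k : set 'rV[R]_k :=
  [set t | forall j, 0 <= t ord0 j <= 1].
Arguments cube : clear implicits.

Definition cube_boundary k : set 'rV[R]_k :=
  cube k `&` [set t | exists j, t ord0 j = 0 \/ t ord0 j = 1].
Arguments cube_boundary : clear implicits.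

(* Maps of pairs (cube, boundary) -> (Y, y); values outside the cube are junk,
   and homotopies ignore them. *)
Record gloop k (Y : topologicalType) (y : Y) := GLoop {
  gloop_fun :> 'rV[R]_k -> Y;
  gloop_cont : {within cube k, continuous gloop_fun};
  gloop_bd : forall t, cube_boundary k t -> gloop_fun t = y }.

HB.instance Definition _ k Y y := gen_eqMixin (@gloop k Y y).
HB.instance Definition _ k Y y := gen_choiceMixin (@gloop k Y y).

Definition gloop_homotopic k (Y : topologicalType) (y : Y)
    (f g : gloop k y) : Prop :=
  exists H : R * 'rV[R]_k -> Y,
    [/\ {within `[0, 1] `*` cube k, continuous H},
        forall t, cube k t -> H (0, t) = f t,
        forall t, cube k t -> H (1, t) = g t &
        forall s t, `[0, 1]%classic s -> cube_boundary k t -> H (s, t) = y].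

Lemma within_comp_sub (S T U : topologicalType) (A : set S) (B : set T)
    (f : T -> U) (g : S -> T) :
  (forall x, A x -> B (g x)) -> continuous g -> {within B, continuous f} ->
  {within A, continuous (f \o g)}.
Proof.
move=> AB gc /subspace_continuousP fc; apply/subspace_continuousP => x Ax.
apply: (cvg_comp g f); last exact: fc (AB _ Ax).
move=> W; rewrite /= !withinE => -[W' nW' WW'].
exists (g @^-1` W'); first exact: gc.
apply/seteqP; split=> z [/= Wz Az]; split=> //.
  have : (W `&` B) (g z) by split=> //; exact: AB.
  by rewrite WW' => -[].
have : (W' `&` B) (g z) by split=> //; exact: AB.
by rewrite -WW' => -[].
Qed.

Lemma within_if (T U : topologicalType) (A : set T) (phi : T -> R) (c : R)
    (f g : T -> U) : closed A -> continuous phi ->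
  {within A `&` [set x | phi x <= c], continuous f} ->
  {within A `&` [set x | c <= phi x], continuous g} ->
  (forall x, A x -> phi x = c -> f x = g x) ->
  {within A, continuous (fun x => if phi x <= c then f x else g x)}.
Proof.
move=> cA phic fc gc fg.
have -> : A = (A `&` [set x | phi x <= c]) `|` (A `&` [set x | c <= phi x]).
  rewrite -setIUr; apply/seteqP; split=> x; last by case.
  by move=> Ax; split=> //=; apply/orP; exact: le_total.
apply: withinU_continuous.
- by apply: closedI => //; apply: (@closed_comp _ _ phi [set r | r <= c]) => //; exact: closed_le.
- by apply: closedI => //; apply: (@closed_comp _ _ phi [set r | c <= r]) => //; exact: closed_ge.
- by apply: subspace_eq_continuous fc => x /set_mem [/= _ xc]; rewrite /from_subspace /= xc.
- apply: subspace_eq_continuous gc => x /set_mem [/= Ax cx].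
  by rewrite /from_subspace /=; case: ifPn => // xc; rewrite fg //; apply/eqP; rewrite eq_le xc.
Qed.

Lemma continuous_row (T : topologicalType) k (f : T -> 'rV[R]_k) :
  (forall j, continuous (fun x => f x ord0 j)) -> continuous f.
Proof.
move=> fc x W [P Px PW]; apply: filterS PW _.
have : \forall z \near x, forall j, P ord0 j (f z ord0 j).
  by apply: filter_forall => j; apply: fc; exact: Px.
by apply: filterS => z Pz i j; rewrite ord1.
Qed.

Lemma continuous_pair (S T U : topologicalType) (f : S -> T) (g : S -> U) :
  continuous f -> continuous g -> continuous (fun x => (f x, g x)).
Proof. by move=> fc gc x; exact: (cvg_pair (fc x) (gc x)). Qed.

Lemma continuous_compT (S T U : topologicalType) (f : S -> T) (g : T -> U) :
  continuous f -> continuous g -> continuous (fun x => g (f x)).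
Proof.
by move=> fc gc x; apply: (@continuous_comp _ _ _ f g); [exact: fc|exact: gc].
Qed.

Lemma continuous_fst (S T : topologicalType) : continuous (@fst S T).
Proof. by move=> p; exact: cvg_fst. Qed.

Lemma continuous_snd (S T : topologicalType) : continuous (@snd S T).
Proof. by move=> p; exact: cvg_snd. Qed.

Lemma continuous_scale (T : topologicalType) (f : T -> R) (a : R) :
  continuous f -> continuous (fun x => a * f x).
Proof. by move=> fc x; apply: cvgM; [exact: cvg_cst|exact: fc]. Qed.

Lemma continuous_flip (T : topologicalType) (f : T -> R) :
  continuous f -> continuous (fun x => 1 - f x).
Proof. by move=> fc x; apply: cvgB; [exact: cvg_cst|exact: fc]. Qed.

Lemma continuous_affine (T : topologicalType) (f : T -> R) (a b : R) :
  continuous f -> continuous (fun x => a * f x + b).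
Proof. by move=> fc x; apply: cvgD; [exact: continuous_scale|exact: cvg_cst]. Qed.

Lemma closed_cube k : closed (cube k).
Proof.
have -> : cube k = \bigcap_(j in [set: 'I_k])
    ((fun t : 'rV[R]_k => t ord0 j) @^-1` `[0, 1]).
  apply/seteqP; split=> t /= ht j; rewrite ?in_itv; first by move=> _; exact: ht.
  by have := ht j I; rewrite /= in_itv.
apply: closed_bigI => j _; apply: closed_comp; last exact: itv_closed.
by move=> t _; exact: coord_continuous.
Qed.

Lemma closed_cylinder k : closed ((`[0, 1] : set R) `*` cube k).
Proof.
have -> : (`[0, 1] : set R) `*` cube k = fst @^-1` `[0, 1] `&` snd @^-1` cube k.
  by [].
apply: closedI; apply: closed_comp.
- by move=> p _; exact: cvg_fst.
- exact: itv_closed.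
- by move=> p _; exact: cvg_snd.
- exact: closed_cube.
Qed.

Section Homotopic.
Variables (k : nat) (Y : topologicalType) (y : Y).
Implicit Types f g h : gloop k y.

Lemma gloop_homotopic_refl f : gloop_homotopic f f.
Proof.
exists (f \o snd); split=> // [|s t _ bt]; last exact: gloop_bd.
apply: within_comp_sub (@gloop_cont _ _ _ f); first by move=> p [].
by move=> p; exact: cvg_snd.
Qed.

Lemma gloop_homotopic_sym f g : gloop_homotopic f g -> gloop_homotopic g f.
Proof.
move=> [H [Hc H0 H1 Hb]].
exists (H \o (fun p => (1 - p.1, p.2))); split=> /=.
- apply: within_comp_sub Hc.
    move=> [s t] [] /=; rewrite !in_itv /= => /andP[s0 s1] ct; split=> //=.
    by apply/andP; split; lra.
  apply: continuous_pair => p; last exact: cvg_snd.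
  by apply: cvgB; [exact: cvg_cst|exact: cvg_fst].
- by move=> t ct; rewrite subr0 H1.
- by move=> t ct; rewrite subrr H0.
- move=> s t; rewrite /= in_itv /= => /andP[s0 s1] bt.
  by apply: Hb => //=; rewrite in_itv /=; apply/andP; split; lra.
Qed.

Lemma gloop_homotopic_trans f g h :
  gloop_homotopic f g -> gloop_homotopic g h -> gloop_homotopic f h.
Proof.
move=> [H [Hc H0 H1 Hb]] [G [Gc G0 G1 Gb]].
exists (fun p => if p.1 <= 1 / 2 then H (2 * p.1, p.2)
                 else G (2 * p.1 - 1, p.2)); split=> /=.
- apply: within_if.
  + exact: closed_cylinder.
  + by move=> p; exact: cvg_fst.
  + apply: (within_comp_sub (g := fun p : R * 'rV[R]_k => (2 * p.1, p.2)) _ _ Hc).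
      move=> [s t] /=; rewrite !in_itv /= => -[[/andP[s0 s1] ct] s2]; split=> //.
      by apply/andP; split; lra.
    apply: continuous_pair => p; last exact: cvg_snd.
    by apply: cvgM; [exact: cvg_cst|exact: cvg_fst].
  + apply: (within_comp_sub (g := fun p : R * 'rV[R]_k => (2 * p.1 - 1, p.2)) _ _ Gc).
      move=> [s t] /=; rewrite !in_itv /= => -[[/andP[s0 s1] ct] s2]; split=> //.
      by apply/andP; split; lra.
    apply: continuous_pair => p; last exact: cvg_snd.
    by apply: continuous_affine => q; exact: cvg_fst.
  + move=> [s t] /= [_ ct] ->.
    have -> : 2 * (1 / 2) = 1 :> R by lra.
    by rewrite subrr H1 // G0.
- move=> t ct; rewrite mulr0 H0 // ifT //; lra.
- move=> t ct; rewrite ifF; last by apply/negbTE; rewrite -ltNge; lra.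
  by rewrite mulr1 (_ : 2 - 1 = 1) ?G1 //; lra.
- move=> s t; rewrite /= in_itv /= => /andP[s0 s1] bt.
  case: ifPn => s2; [apply: Hb => //|apply: Gb => //]; rewrite /= in_itv /=;
    apply/andP; split; lra.
Qed.

Definition gloop_eqb f g : bool := `[< gloop_homotopic f g >].

Let gloop_eqb_refl : reflexive gloop_eqb.
Proof. by move=> f; apply/asboolP; exact: gloop_homotopic_refl. Qed.

Let gloop_eqb_sym : symmetric gloop_eqb.
Proof. by move=> f g; apply: asbool_equiv_eq; split; exact: gloop_homotopic_sym. Qed.

Let gloop_eqb_trans : transitive gloop_eqb.
Proof.
move=> g f h /asboolP fg /asboolP gh; apply/asboolP.
exact: gloop_homotopic_trans gh.
Qed.

Canonical gloop_equiv :=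
  EquivRel gloop_eqb gloop_eqb_refl gloop_eqb_sym gloop_eqb_trans.

(* For k = 0 the cube is a point with empty boundary, and this is the set of path
   components of Y; a group structure is given below for k > 0. *)
Definition homotopy_group := {eq_quot gloop_equiv}%qT.

HB.instance Definition _ := Choice.on homotopy_group.

Definition gloop_class (f : gloop k y) : homotopy_group :=
  (\pi_{eq_quot gloop_equiv}%qT f)%qT.

Lemma gloop_classP f g :
  gloop_class f = gloop_class g <-> gloop_homotopic f g.
Proof.
split=> [/eqP|fg]; first by rewrite eqmodE => /asboolP.
by apply/eqP; rewrite eqmodE; apply/asboolP.
Qed.

Lemma gloop_class_ind (P : homotopy_group -> Prop) :
  (forall f, P (gloop_class f)) -> forall a, P a.
Proof. by move=> Pf a; rewrite -[a]reprK; exact: Pf. Qed.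

Let cst_cont : {within cube k, continuous (fun _ : 'rV[R]_k => y)}.
Proof. by apply: continuous_subspaceT; exact: cst_continuous. Qed.

Definition gloop_cst : gloop k y := GLoop cst_cont (fun _ _ => erefl).

Definition homotopy_group_base : homotopy_group := gloop_class gloop_cst.

End Homotopic.

Section GroupLaw.
Variables (n : nat) (Y : topologicalType) (y : Y).
Implicit Types f g h p q : gloop n.+1 y.
Implicit Types (a b : R) (t : 'rV[R]_n.+1).

Definition set_first (a : R) (t : 'rV[R]_n.+1) : 'rV[R]_n.+1 :=
  \row_j (if j == ord0 then a else t ord0 j).

Lemma set_firstE a t : set_first a t ord0 ord0 = a.
Proof. by rewrite mxE eqxx. Qed.

Lemma set_first_set a b t : set_first a (set_first b t) = set_first a t.
Proof. by apply/rowP => j; rewrite !mxE; case: eqP. Qed.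

Lemma set_first_id t : set_first (t ord0 ord0) t = t.
Proof. by apply/rowP => j; rewrite mxE; case: eqP => [->|]. Qed.

Lemma cube_set_first a t : 0 <= a <= 1 -> cube n.+1 t ->
  cube n.+1 (set_first a t).
Proof. by move=> a01 ct j; rewrite mxE; case: eqP. Qed.

Lemma cube_first t : cube n.+1 t -> 0 <= t ord0 ord0 <= 1.
Proof. exact. Qed.

Lemma cube_boundary_first a t : a = 0 \/ a = 1 -> cube n.+1 t ->
  cube_boundary n.+1 (set_first a t).
Proof.
move=> a01 ct; split; last by exists ord0; rewrite set_firstE.
by apply: cube_set_first => //; case: a01 => ->; rewrite lexx ler01.
Qed.

Lemma cube_boundary_cases t : cube_boundary n.+1 t ->
  (t ord0 ord0 = 0 \/ t ord0 ord0 = 1) \/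
  (forall a, 0 <= a <= 1 -> cube_boundary n.+1 (set_first a t)).
Proof.
move=> [ct [j tj]]; have [j0|j0] := eqVneq j ord0.
  by left; rewrite -j0.
right => a a01; split; first exact: cube_set_first.
by exists j; rewrite mxE (negbTE j0).
Qed.

Lemma continuous_set_first (T : topologicalType) (a : T -> R)
    (b : T -> 'rV[R]_n.+1) : continuous a -> continuous b ->
  continuous (fun x => set_first (a x) (b x)).
Proof.
move=> ac bc; apply: continuous_row => j.
rewrite (_ : (fun x => _) = fun x => if j == ord0 then a x else b x ord0 j).
  by case: eqP => // _; exact: (continuous_compT bc (@coord_continuous R _ _ _ _)).
by apply/funext => x; rewrite mxE.
Qed.

Lemma first_continuous : continuous (fun t : 'rV[R]_n.+1 => t ord0 ord0).
Proof. exact: coord_continuous. Qed.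

Lemma gloop_homotopic_reparam f p q (phi psi : R -> R) :
  continuous phi -> continuous psi ->
  (forall x, 0 <= x <= 1 -> 0 <= phi x <= 1) ->
  (forall x, 0 <= x <= 1 -> 0 <= psi x <= 1) ->
  phi 0 = psi 0 -> phi 1 = psi 1 ->
  (forall t, cube n.+1 t -> p t = f (set_first (phi (t ord0 ord0)) t)) ->
  (forall t, cube n.+1 t -> q t = f (set_first (psi (t ord0 ord0)) t)) ->
  gloop_homotopic p q.
Proof.
move=> phic psic phi01 psi01 e0 e1 pE qE.
pose a (z : R * 'rV[R]_n.+1) :=
  (1 - z.1) * phi (z.2 ord0 ord0) + z.1 * psi (z.2 ord0 ord0).
have a01 s t : 0 <= s <= 1 -> cube n.+1 t -> 0 <= a (s, t) <= 1.
  move=> /andP[s0 s1] /cube_first t01; rewrite /a /=.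
  have /andP[? ?] := phi01 _ t01; have /andP[? ?] := psi01 _ t01.
  by apply/andP; split; nra.
have fstc := @continuous_fst R 'rV[R]_n.+1.
have sndc := continuous_compT (@continuous_snd R _) first_continuous.
exists (f \o (fun z => set_first (a z) z.2)); split=> /=.
- apply: within_comp_sub (@gloop_cont _ _ _ f).
    move=> [s t] [] /=; rewrite in_itv /= => s01 ct.
    by apply: cube_set_first => //; exact: a01.
  apply: continuous_set_first => z; last exact: cvg_snd.
  apply: cvgD; apply: cvgM.
  + exact: continuous_flip.
  + exact: (continuous_compT sndc phic).
  + exact: fstc.
  + exact: (continuous_compT sndc psic).
- by move=> t ct; rewrite pE // /a /= subr0 mul1r mul0r addr0.
- by move=> t ct; rewrite qE // /a /= subrr mul1r mul0r add0r.
- move=> s t; rewrite /= in_itv /= => s01 bt; have ct : cube n.+1 t by case: bt.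
  have [t01|bt'] := cube_boundary_cases bt; last first.
    by apply: gloop_bd; apply: bt'; exact: a01.
  rewrite (_ : a (s, t) = phi (t ord0 ord0)) -?pE //; first exact: gloop_bd.
  by rewrite /a /=; case: t01 => ->; rewrite -?e0 -?e1; ring.
Qed.

Definition concat_fun f g (t : 'rV[R]_n.+1) : Y :=
  if t ord0 ord0 <= 1 / 2 then f (set_first (2 * t ord0 ord0) t)
  else g (set_first (2 * t ord0 ord0 - 1) t).

Let concat_cont f g : {within cube n.+1, continuous (concat_fun f g)}.
Proof.
have fc := @first_continuous.
apply: within_if.
- exact: closed_cube.
- exact: fc.
- apply: (within_comp_sub (g := fun t : 'rV[R]_n.+1 =>
    set_first (2 * t ord0 ord0) t) _ _ (@gloop_cont _ _ _ f)).
    move=> t [/= ct t2]; apply: cube_set_first => //.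
    by have /andP[? ?] := cube_first ct; apply/andP; split; lra.
  apply: continuous_set_first; last by move=> t; exact: cvg_id.
  exact: continuous_scale.
- apply: (within_comp_sub (g := fun t : 'rV[R]_n.+1 =>
    set_first (2 * t ord0 ord0 - 1) t) _ _ (@gloop_cont _ _ _ g)).
    move=> t [/= ct t2]; apply: cube_set_first => //.
    by have /andP[? ?] := cube_first ct; apply/andP; split; lra.
  apply: continuous_set_first => [|t]; last exact: cvg_id.
  exact: continuous_affine.
- move=> t ct ->; rewrite !gloop_bd //; apply: cube_boundary_first => //.
    by left; lra.
  by right; lra.
Qed.

Let concat_bd f g t : cube_boundary n.+1 t -> concat_fun f g t = y.
Proof.
move=> bt; have ct : cube n.+1 t by case: bt.
have /andP[t0 t1] := cube_first ct; rewrite /concat_fun.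
have [t01|bt'] := cube_boundary_cases bt; last first.
  by case: ifPn => t2; apply: gloop_bd; apply: bt'; apply/andP; split; lra.
case: t01 => ->.
  case: ifPn => t2; last by exfalso; case/negP: t2; lra.
  by apply: gloop_bd; apply: cube_boundary_first => //; left; lra.
case: ifPn => t2; first by exfalso; lra.
by apply: gloop_bd; apply: cube_boundary_first => //; right; lra.
Qed.

Definition gloop_concat f g : gloop n.+1 y :=
  GLoop (@concat_cont f g) (@concat_bd f g).

Definition reverse_fun f (t : 'rV[R]_n.+1) : Y :=
  f (set_first (1 - t ord0 ord0) t).

Let reverse_cont f : {within cube n.+1, continuous (reverse_fun f)}.
Proof.
apply: (within_comp_sub (g := fun t : 'rV[R]_n.+1 =>
    set_first (1 - t ord0 ord0) t) _ _ (@gloop_cont _ _ _ f)).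
  move=> t ct; apply: cube_set_first => //.
  by have /andP[? ?] := cube_first ct; apply/andP; split; lra.
apply: continuous_set_first; last by move=> t; exact: cvg_id.
exact: continuous_flip first_continuous.
Qed.

Let reverse_bd f t : cube_boundary n.+1 t -> reverse_fun f t = y.
Proof.
move=> bt; have ct : cube n.+1 t by case: bt.
have /andP[t0 t1] := cube_first ct; apply: gloop_bd.
have [t01|] := cube_boundary_cases bt; last by apply; apply/andP; split; lra.
by apply: cube_boundary_first => //; case: t01 => ->; [right|left]; lra.
Qed.

Definition gloop_reverse f : gloop n.+1 y :=
  GLoop (@reverse_cont f) (@reverse_bd f).

Lemma gloop_concat_homotopic f f' g g' :
  gloop_homotopic f f' -> gloop_homotopic g g' ->
  gloop_homotopic (gloop_concat f g) (gloop_concat f' g').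
Proof.
move=> [H [Hc H0 H1 Hb]] [G [Gc G0 G1 Gb]].
pose u (z : R * 'rV[R]_n.+1) := z.2 ord0 ord0.
have uc : continuous u.
  exact: (continuous_compT (@continuous_snd R _) first_continuous).
pose L (z : R * 'rV[R]_n.+1) := (z.1, set_first (2 * u z) z.2).
pose M (z : R * 'rV[R]_n.+1) := (z.1, set_first (2 * u z - 1) z.2).
exists (fun z => if u z <= 1 / 2 then H (L z) else G (M z)); split=> /=.
- apply: within_if => //; first exact: closed_cylinder.
  + apply: (within_comp_sub (g := L) _ _ Hc).
      move=> [s t] /=; rewrite in_itv /= => -[[s01 ct]] t2; split=> //=.
      apply: cube_set_first => //.
      by have /andP[? ?] := cube_first ct; apply/andP; split; rewrite /u /= in t2 *; lra.
    apply: continuous_pair => [z|]; first exact: cvg_fst.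
    apply: continuous_set_first; last exact: continuous_snd.
    exact: continuous_scale.
  + apply: (within_comp_sub (g := M) _ _ Gc).
      move=> [s t] /=; rewrite in_itv /= => -[[s01 ct]] t2; split=> //=.
      apply: cube_set_first => //.
      by have /andP[? ?] := cube_first ct; apply/andP; split; rewrite /u /= in t2 *; lra.
    apply: continuous_pair => [z|]; first exact: cvg_fst.
    apply: continuous_set_first => [|z]; last exact: cvg_snd.
    exact: continuous_affine.
  + move=> [s t] /= [s01 ct] ut; rewrite /L /M ut Hb ?Gb //=;
      apply: cube_boundary_first => //.
      by left; lra.
    by right; lra.
- move=> t ct; rewrite /concat_fun /L /M /u /=.
  have /andP[t0 t1] := cube_first ct.
  by case: ifPn => t2; rewrite ?H0 ?G0 //; apply: cube_set_first => //;
    apply/andP; split; lra.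
- move=> t ct; rewrite /concat_fun /L /M /u /=.
  have /andP[t0 t1] := cube_first ct.
  by case: ifPn => t2; rewrite ?H1 ?G1 //; apply: cube_set_first => //;
    apply/andP; split; lra.
- move=> s t s01 bt; have ct : cube n.+1 t by case: bt.
  have /andP[t0 t1] := cube_first ct; rewrite /L /M /u /=.
  have [t01|bt'] := cube_boundary_cases bt; last first.
    by case: ifPn => t2; [apply: Hb => //|apply: Gb => //]; apply: bt';
      apply/andP; split; lra.
  case: t01 => ->.
    case: ifPn => t2; last by exfalso; case/negP: t2; lra.
    by apply: Hb => //; apply: cube_boundary_first => //; left; lra.
  case: ifPn => t2; first by exfalso; lra.
  by apply: Gb => //; apply: cube_boundary_first => //; right; lra.
Qed.

Lemma gloop_reverse_homotopic f f' : gloop_homotopic f f' ->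
  gloop_homotopic (gloop_reverse f) (gloop_reverse f').
Proof.
move=> [H [Hc H0 H1 Hb]].
pose L (z : R * 'rV[R]_n.+1) := (z.1, set_first (1 - z.2 ord0 ord0) z.2).
have r01 t : cube n.+1 t -> 0 <= 1 - t ord0 ord0 <= 1.
  by move=> /cube_first /andP[? ?]; apply/andP; split; lra.
exists (H \o L); split=> /=.
- apply: within_comp_sub Hc.
    move=> [s t] [/= s01 ct]; split=> //=; apply: cube_set_first => //.
    exact: r01.
  apply: continuous_pair => [z|]; first exact: cvg_fst.
  apply: continuous_set_first; last exact: continuous_snd.
  apply: continuous_flip.
  exact: (continuous_compT (@continuous_snd R _) first_continuous).
- by move=> t ct; rewrite H0 //; apply: cube_set_first => //; exact: r01.
- by move=> t ct; rewrite H1 //; apply: cube_set_first => //; exact: r01.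
- move=> s t s01 bt; have ct : cube n.+1 t by case: bt.
  apply: Hb => //=; have [t01|] := cube_boundary_cases bt; last by apply; exact: r01.
  by apply: cube_boundary_first => //; case: t01 => ->; [right|left]; lra.
Qed.

Let continuous_minr (T : topologicalType) (a b : T -> R) : continuous a ->
  continuous b -> continuous (fun x => Num.min (a x) (b x)).
Proof. by move=> ac bc x; apply: continuous_min; [exact: ac|exact: bc]. Qed.

Let continuous_maxr (T : topologicalType) (a b : T -> R) : continuous a ->
  continuous b -> continuous (fun x => Num.max (a x) (b x)).
Proof. by move=> ac bc x; apply: continuous_max; [exact: ac|exact: bc]. Qed.

Lemma gloop_concatA f g h :
  gloop_homotopic (gloop_concat f (gloop_concat g h))
                  (gloop_concat (gloop_concat f g) h).
Proof.
pose phi (x : R) :=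
  Num.min (2 * x + 0) (Num.min (1 * x + 1 / 4) (2^-1 * x + 1 / 2)).
have phi1 x : x <= 1 / 4 -> phi x = 2 * x.
  by move=> ?; rewrite /phi !minEle; do !case: ifPn; rewrite -?ltNge; lra.
have phi2 x : 1 / 4 <= x -> x <= 1 / 2 -> phi x = x + 1 / 4.
  by move=> ? ?; rewrite /phi !minEle; do !case: ifPn; rewrite -?ltNge; lra.
have phi3 x : 1 / 2 <= x -> phi x = x / 2 + 1 / 2.
  by move=> ?; rewrite /phi !minEle; do !case: ifPn; rewrite -?ltNge; lra.
apply: (@gloop_homotopic_reparam (gloop_concat f (gloop_concat g h)) _ _ id phi).
- by move=> x; exact: cvg_id.
- by do 2?apply: continuous_minr; apply: continuous_affine => x; exact: cvg_id.
- by [].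
- move=> x /andP[x0 x1]; rewrite /phi !le_min !ge_min.
  by apply/andP; split; [apply/and3P; split|apply/or3P; constructor 3]; lra.
- by rewrite phi1; lra.
- by rewrite phi3; lra.
- by move=> t ct; rewrite set_first_id.
move=> t /cube_first /andP[t0 t1].
set a := t ord0 ord0 in t0 t1 *.
rewrite /= /concat_fun /= /concat_fun !set_firstE !set_first_set.
have [a2|a2] := leP a (1 / 2).
  have [a4|a4] := leP (2 * a) (1 / 2).
    have -> : phi a = 2 * a by apply: phi1; lra.
    by rewrite ifT //; lra.
  have -> : phi a = a + 1 / 4 by apply: phi2; lra.
  case: ifPn => b1; first by exfalso; lra.
  case: ifPn => b2; last by exfalso; case/negP: b2; lra.
  by congr (g (set_first _ _)); rewrite /a; lra.
have -> : phi a = a / 2 + 1 / 2 by apply: phi3; lra.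
case: ifPn => b1; first by exfalso; lra.
case: ifPn => b2; first by exfalso; lra.
by congr (h (set_first _ _)); rewrite /a; lra.
Qed.

Lemma gloop_concat1l f : gloop_homotopic (gloop_concat (gloop_cst _ y) f) f.
Proof.
pose phi (x : R) := Num.max 0 (2 * x - 1).
apply: (@gloop_homotopic_reparam f _ _ phi id).
- apply: continuous_maxr; first exact: cst_continuous.
  by apply: continuous_affine => ?; exact: cvg_id.
- by move=> x; exact: cvg_id.
- by move=> x /andP[? ?]; rewrite /phi maxEle; case: ifPn; rewrite -?ltNge => ?;
    apply/andP; split; lra.
- by [].
- by rewrite /phi maxEle; case: ifPn; rewrite -?ltNge; lra.
- by rewrite /phi maxEle; case: ifPn; rewrite -?ltNge; lra.
- move=> t ct; rewrite /= /concat_fun /phi /=; case: ifPn => t2.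
    by rewrite max_l ?gloop_bd //; [apply: cube_boundary_first => //; left|lra].
  by move: t2; rewrite -ltNge => t2; rewrite max_r //; lra.
- by move=> t ct; rewrite set_first_id.
Qed.

Lemma gloop_concat1r f : gloop_homotopic (gloop_concat f (gloop_cst _ y)) f.
Proof.
pose phi (x : R) := Num.min 1 (2 * x).
apply: (@gloop_homotopic_reparam f _ _ phi id).
- apply: continuous_minr; first exact: cst_continuous.
  by apply: continuous_scale => ?; exact: cvg_id.
- by move=> x; exact: cvg_id.
- by move=> x /andP[? ?]; rewrite /phi minEle; case: ifPn; rewrite -?ltNge => ?;
    apply/andP; split; lra.
- by [].
- by rewrite /phi minEle; case: ifPn; rewrite -?ltNge; lra.
- by rewrite /phi minEle; case: ifPn; rewrite -?ltNge; lra.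
- move=> t ct; rewrite /= /concat_fun /phi /=; case: ifPn => t2.
    by rewrite min_r //; lra.
  rewrite min_l ?gloop_bd //; first by apply: cube_boundary_first => //; right.
  by rewrite -ltNge in t2; lra.
- by move=> t ct; rewrite set_first_id.
Qed.

Let tent (x : R) := `|2 * x - 1|.

Let tentc : continuous tent.
Proof.
apply: (@continuous_compT _ _ _ (fun x : R => 2 * x - 1)); last exact: norm_continuous.
by apply: continuous_affine => x; exact: cvg_id.
Qed.

Let tent01 x : 0 <= x <= 1 -> 0 <= tent x <= 1.
Proof.
by move=> /andP[? ?]; rewrite /tent normr_ge0 /= ler_norml; apply/andP; split; lra.
Qed.

Let tent_lo x : x <= 1 / 2 -> tent x = 1 - 2 * x.
Proof. by move=> ?; rewrite /tent ler0_norm; lra. Qed.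

Let tent_hi x : 1 / 2 <= x -> tent x = 2 * x - 1.
Proof. by move=> ?; rewrite /tent ger0_norm //; lra. Qed.

Lemma gloop_concatVl f :
  gloop_homotopic (gloop_concat (gloop_reverse f) f) (gloop_cst _ y).
Proof.
apply: (@gloop_homotopic_reparam f _ _ tent (fun=> 1)).
- exact: tentc.
- exact: cst_continuous.
- exact: tent01.
- by move=> x _; rewrite ler01 lexx.
- by rewrite tent_lo; lra.
- by rewrite tent_hi; lra.
- move=> t ct; rewrite /= /concat_fun /= /reverse_fun set_firstE set_first_set.
  case: ifPn => t2; first by rewrite tent_lo.
  by rewrite tent_hi // ltW // ltNge.
- by move=> t ct /=; rewrite gloop_bd //; apply: cube_boundary_first => //; right.
Qed.

Lemma gloop_concatVr f :
  gloop_homotopic (gloop_concat f (gloop_reverse f)) (gloop_cst _ y).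
Proof.
apply: (@gloop_homotopic_reparam f _ _ (fun x => 1 - tent x) (fun=> 0)).
- exact: continuous_flip tentc.
- exact: cst_continuous.
- by move=> x /tent01 /andP[? ?]; apply/andP; split; lra.
- by move=> x _; rewrite ler01 lexx.
- by rewrite tent_lo; lra.
- by rewrite tent_hi; lra.
- move=> t ct; rewrite /= /concat_fun /= /reverse_fun set_firstE set_first_set.
  case: ifPn => t2; last by rewrite tent_hi // ltW // ltNge.
  by rewrite tent_lo // subKr.
- by move=> t ct /=; rewrite gloop_bd //; apply: cube_boundary_first => //; left.
Qed.

Let G := homotopy_group n.+1 y.

Let mulG (a b : G) : G := gloop_class (gloop_concat (repr a) (repr b)).

Let invG (a : G) : G := gloop_class (gloop_reverse (repr a)).

Let gloop_class_repr f : gloop_homotopic (repr (gloop_class f)) f.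
Proof. by apply/gloop_classP; exact: reprK. Qed.

Let mulGE f g : mulG (gloop_class f) (gloop_class g) = gloop_class (gloop_concat f g).
Proof. by apply/gloop_classP; exact: gloop_concat_homotopic. Qed.

Let invGE f : invG (gloop_class f) = gloop_class (gloop_reverse f).
Proof. by apply/gloop_classP; exact: gloop_reverse_homotopic. Qed.

Let mulGA : associative mulG.
Proof.
elim/gloop_class_ind => f; elim/gloop_class_ind => g; elim/gloop_class_ind => h.
by rewrite !mulGE; apply/gloop_classP; exact: gloop_concatA.
Qed.

Let mul1G : left_id (homotopy_group_base n.+1 y) mulG.
Proof.
elim/gloop_class_ind => f; rewrite mulGE.
by apply/gloop_classP; exact: gloop_concat1l.
Qed.

Let mulG1 : right_id (homotopy_group_base n.+1 y) mulG.
Proof.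
elim/gloop_class_ind => f; rewrite mulGE.
by apply/gloop_classP; exact: gloop_concat1r.
Qed.

Let mulVG : left_inverse (homotopy_group_base n.+1 y) invG mulG.
Proof.
elim/gloop_class_ind => f; rewrite invGE mulGE.
by apply/gloop_classP; exact: gloop_concatVl.
Qed.

Let mulGV : right_inverse (homotopy_group_base n.+1 y) invG mulG.
Proof.
elim/gloop_class_ind => f; rewrite invGE mulGE.
by apply/gloop_classP; exact: gloop_concatVr.
Qed.

HB.instance Definition _ := isGroup.Build (homotopy_group n.+1 y)
  mulGA mul1G mulG1 mulVG mulGV.

Lemma gloop_classM f g :
  (gloop_class f * gloop_class g)%g = gloop_class (gloop_concat f g).
Proof. exact: mulGE. Qed.

End GroupLaw.

(* An isomorphism of pointed sets for k = 0, of groups for k > 0. *)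
Definition homotopy_group_iso k (Y Y' : topologicalType)
    (y : Y) (y' : Y') : Prop :=
  match k with
  | 0 => exists2 phi : homotopy_group 0 y -> homotopy_group 0 y',
           bijective phi & phi (homotopy_group_base 0 y) = homotopy_group_base 0 y'
  | n.+1 => exists2 phi : homotopy_group n.+1 y -> homotopy_group n.+1 y',
           bijective phi & {morph phi : a b / (a * b)%g}
  end.

Definition path_component (Y : topologicalType) (y : Y) : set Y :=
  [set z | exists f : R -> Y,
    [/\ {within `[0, 1], continuous f}, f 0 = y & f 1 = z]].

Definition path_components (Y : topologicalType) : set (set Y) :=
  range (@path_component Y).
Arguments path_components : clear implicits.

Definition transversal_of_path_components (Y : topologicalType) (S : set Y) :=
  forall C, path_components Y C -> exists! y, (S `&` C) y.

(* No map Y -> Y' inducing the isomorphisms is required. *)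
Definition isomorphic_homotopy_groups (Y Y' : topologicalType) : Prop :=
  (path_components Y #= path_components Y')%card /\
  exists (S : set Y) (S' : set Y') (h : Y -> Y'),
    [/\ transversal_of_path_components S,
        transversal_of_path_components S',
        set_bij S S' h &
        forall y, S y -> forall k, homotopy_group_iso k y (h y)].

End HomotopyGroups.

(* Main.v *)
(* Both spaces have the same points, and to_thickening : V(U) -> V^m(U) is
   continuous on compact sets; its inverse to_complex is not continuous, but the
   bijection induces isomorphisms on homotopy groups.

   To compress a map f from a cube into V^m(U) to one that is continuous into
   V(U): near a parameter c, all but an arbitrarily small part of the mass of f t
   stays in a set U_c of the cover that contains the support of f c. Refine the
   resulting open cover of the n-cube by a grid in which at most 7^n cells are
   relevant for each t; if the exceptional masses are below 1 / (7^n + 1), then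
   f t still charges the intersection of the relevant sets U_c. Cutting f t off
   to this intersection is a linear homotopy inside the support of f t, and the
   result shares a set of the cover with the simplex spanned by points chosen in
   the same way at the neighbouring grid points, so that a second linear homotopy
   leads to a map into a finite subcomplex of V(U). Where f is already continuous
   into V(U), compactness confines it to a finite subcomplex and the homotopy is
   continuous into V(U) as well. Reparametrizing it in a collar of the cube makes
   it relative to the boundary. *)
Require Import Defs.
From mathcomp Require Import all_boot all_order all_algebra finmap.
From mathcomp Require Import all_classical all_reals all_analysis.
From mathcomp Require Import ring lra.

Set Implicit Arguments.
Unset Strict Implicit.
Unset Printing Implicit Defensive.

Import Order.TTheory GRing.Theory Num.Theory.
Import numFieldNormedType.Exports.

Local Open Scope classical_set_scope.
Local Open Scope ring_scope.

(** * Finitely supported probability measures and the Wasserstein distance *)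

Section Expectation.
Variables (R : realType) (V : choiceType).
Implicit Types (mu : finprob R V) (h : V -> R) (A : {fset V}).

Definition expect mu h : R := \sum_(v <- finsupp mu) h v * mu v.

Lemma expect_sub mu h A : (finsupp mu `<=` A)%fset ->
  expect mu h = \sum_(v <- A) h v * mu v.
Proof.
move=> muA; rewrite /expect; apply: big_fset_incl => // v _ vmu.
by rewrite fsfun_dflt ?mulr0.
Qed.

Lemma expectT mu h : expect mu h = \sum_(v : finsupp mu) h (val v) * mu (val v).
Proof. by rewrite /expect big_seq_fsetE. Qed.

Lemma mass_sum_sub mu A : (finsupp mu `<=` A)%fset -> \sum_(v <- A) mu v = 1.
Proof.
move=> muA; rewrite -(mass_sum1 mu); apply/esym; apply: big_fset_incl => // v _ vmu.
by rewrite fsfun_dflt.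
Qed.

Lemma mass_gt0P mu v : reflect (0 < mu v) (v \in finsupp mu).
Proof. by rewrite mem_finsupp lt_def mass_ge0 andbT; exact: idP. Qed.

Lemma expect_le mu h h' : (forall v, v \in finsupp mu -> h v <= h' v) ->
  expect mu h <= expect mu h'.
Proof.
move=> hh'; rewrite /expect !big_seq; apply: ler_sum => v vmu.
by rewrite ler_wpM2r ?mass_ge0 ?hh'.
Qed.

Lemma eq_expect mu h h' : (forall v, v \in finsupp mu -> h v = h' v) ->
  expect mu h = expect mu h'.
Proof.
move=> hh'; rewrite /expect !big_seq; apply: eq_bigr => v vmu.
by rewrite hh'.
Qed.

Lemma expect_cst mu (a : R) : expect mu (fun=> a) = a.
Proof. by rewrite /expect -mulr_sumr mass_sum1 mulr1. Qed.

Lemma expectD mu h h' : expect mu (fun v => h v + h' v) = expect mu h + expect mu h'.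
Proof. by rewrite /expect -big_split /=; apply: eq_bigr => v _; rewrite mulrDl. Qed.

Lemma expectZ mu h (a : R) : expect mu (fun v => a * h v) = a * expect mu h.
Proof. by rewrite /expect mulr_sumr; apply: eq_bigr => v _; rewrite mulrA. Qed.

Lemma expect_sum mu (J : Type) (r : seq J) (F : J -> V -> R) :
  expect mu (fun v => \sum_(j <- r) F j v) = \sum_(j <- r) expect mu (F j).
Proof.
elim: r => [|j r IH].
  by rewrite big_nil (@eq_expect _ _ (fun=> 0)) ?expect_cst // => v _; rewrite big_nil.
rewrite big_cons -IH -expectD; apply: eq_expect => v _.
by rewrite big_cons.
Qed.

Lemma finsupp_neq0 mu : exists v, v \in finsupp mu.
Proof.
have [/eqP e|/fset0Pn[v]] := boolP (finsupp mu == fset0); last by exists v.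
by have := mass_sum1 mu; rewrite e big_seq_fset0 => /eqP; rewrite eq_sym oner_eq0.
Qed.

Lemma finprob_of_mass A (m : V -> R) : (forall v, 0 <= m v) ->
  (forall v, v \notin A -> m v = 0) -> \sum_(v <- A) m v = 1 ->
  exists mu : finprob R V, mass mu =1 m.
Proof.
move=> m0 mA m1; pose f : {fsfun V -> R with 0} := [fsfun v in A => m v].
have fE v : f v = m v.
  by rewrite fsfunE; case: ifPn => // /mA.
have f0 v : 0 <= f v by rewrite fE.
have f1 : \sum_(v <- finsupp f) f v = 1.
  rewrite -m1; under [RHS]eq_bigr do rewrite -fE.
  apply: big_fset_incl => [|v _ vf]; last by rewrite fsfun_dflt.
  by apply/fsubsetP => v; rewrite mem_finsupp; apply: contraR => vA; rewrite fE mA.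
by exists (FinProb f0 f1).
Qed.

End Expectation.

(** * Lipschitz test functions and bounds on the Wasserstein distance *)

Section Lipschitz.
Variables (R : realType) (X : metricType R).
Implicit Types (mu nu : finprob R X) (h : X -> R).

(** The test functions for convergence of measures. Values in the unit interval make the class
    stable under products and complements, from which the cut-offs are built; the Lipschitz constant
    is arbitrary. *)
Definition unit_lipschitz h : Prop := (forall x, 0 <= h x <= 1) /\
  exists2 L, 0 < L & forall x y, `|h x - h y| <= L * mdist x y.

Lemma unit_lipschitz1 : unit_lipschitz (fun=> 1).
Proof.
split=> [x|]; first by rewrite ler01 lexx.
by exists 1 => // x y; rewrite subrr normr0 mul1r mdist_ge0.
Qed.

Lemma unit_lipschitzC h : unit_lipschitz h -> unit_lipschitz (fun x => 1 - h x).
Proof.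
move=> [h01 [L L0 hL]]; split=> [x|].
  by have /andP[? ?] := h01 x; apply/andP; split; lra.
exists L => // x y; rewrite (_ : _ - _ = h y - h x); first by rewrite distrC.
by ring.
Qed.

Lemma unit_lipschitzM h g : unit_lipschitz h -> unit_lipschitz g ->
  unit_lipschitz (fun x => h x * g x).
Proof.
move=> [h01 [L L0 hL]] [g01 [M M0 gM]]; split=> [x|].
  have /andP[? ?] := h01 x; have /andP[? ?] := g01 x.
  by rewrite mulr_ge0 //= mulr_ile1.
exists (L + M) => [|x y]; first exact: addr_gt0.
rewrite (_ : _ - _ = (h x - h y) * g x + h y * (g x - g y)); last by ring.
rewrite (le_trans (ler_normD _ _)) // !normrM mulrDl.
have /andP[? ?] := h01 y; have /andP[? ?] := g01 x.
rewrite !(@ger0_norm _ (h y)) // !(@ger0_norm _ (g x)) //.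
have := hL x y; have := gM x y; have := @normr_ge0 _ _ (h x - h y).
have := @normr_ge0 _ _ (g x - g y); nra.
Qed.

Lemma unit_lipschitz_prod (J : Type) (r : seq J) (F : J -> X -> R) :
  (forall j, unit_lipschitz (F j)) ->
  unit_lipschitz (fun x => \prod_(j <- r) F j x).
Proof.
move=> FL; elim: r => [|j r IH].
  rewrite (_ : (fun x => _) = fun=> 1); first exact: unit_lipschitz1.
  by apply/funext => x; rewrite big_nil.
rewrite (_ : (fun x => _) = fun x => F j x * \prod_(i <- r) F i x).
  exact: unit_lipschitzM.
by apply/funext => x; rewrite big_cons.
Qed.

Definition bump (x : X) (r : R) (y : X) : R := Num.max 0 (1 - mdist x y / r).

Lemma bump_gt0 x r y : 0 < r -> 0 < bump x r y -> mdist x y < r.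
Proof.
move=> r0; rewrite /bump lt_max ltxx /= subr_gt0 ltr_pdivrMr ?mul1r //.
Qed.

Lemma bumpxx x r : bump x r x = 1.
Proof. by rewrite /bump mdistxx mul0r subr0 max_r. Qed.

Lemma unit_lipschitz_bump x r : 0 < r -> unit_lipschitz (bump x r).
Proof.
move=> r0; split=> [y|].
  rewrite /bump le_max lexx /= ge_max ler01 /= lerBlDr lerDl.
  by rewrite divr_ge0 ?mdist_ge0 // ltW.
exists r^-1 => [|y z]; first by rewrite invr_gt0.
have tri a b : `|Num.max 0 a - Num.max 0 b| <= `|a - b| :> R.
  by rewrite !maxEle; do 2!case: ifPn; rewrite -?ltNge => *; rewrite !ler_norml;
     have := ler_norm (a - b); have := ler_norm (b - a); rewrite (distrC b a) => *;
     apply/andP; split; have := normr_ge0 (a - b); lra.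
apply: (le_trans (tri _ _)).
rewrite (_ : _ - _ = r^-1 * (mdist x z - mdist x y)); last by ring.
rewrite normrM gtr0_norm ?invr_gt0 // ler_pM2l ?invr_gt0 //.
have := metric_triangle x y z; have := metric_triangle x z y.
rewrite (metric_sym z y) => ? ?.
by rewrite ler_norml; apply/andP; split; lra.
Qed.

Lemma coupling_sum_mul mu nu (c : finsupp mu -> finsupp nu -> R) h :
  coupling c -> \sum_x \sum_y c x y * h (val x) = expect mu h.
Proof.
move=> [_ c1 _]; rewrite expectT; apply: eq_bigr => x _.
by rewrite -mulr_suml c1 mulrC.
Qed.

(** The easy half of Kantorovich duality: for a coupling [c] the difference of expectations is the
    sum of [c x y * (h x - h y)], bounded termwise by [L] times the cost. *)
Lemma expect_wasserstein mu nu h L : 0 < L ->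
  (forall x y, `|h x - h y| <= L * mdist x y) ->
  `|expect mu h - expect nu h| <= L * wasserstein mu nu.
Proof.
move=> L0 hL; rewrite mulrC -ler_pdivrMr //; apply: le_wasserstein => c cc.
rewrite ler_pdivrMr // mulrC.
rewrite -(coupling_sum_mul h cc).
have -> : expect nu h = \sum_x \sum_y c x y * h (val y).
  case: cc => _ _ c2; rewrite exchange_big /= expectT; apply: eq_bigr => y _.
  by rewrite -mulr_suml c2 mulrC.
rewrite -sumrB mulr_sumr (le_trans (ler_norm_sum _ _ _)) //; apply: ler_sum => x _.
rewrite -sumrB mulr_sumr (le_trans (ler_norm_sum _ _ _)) //; apply: ler_sum => y _.
case: cc => c0 _ _; rewrite -mulrBr normrM ger0_norm // mulrCA.
by rewrite ler_wpM2l.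
Qed.

(* A partial coupling is completed by the product coupling of what is left over. *)
Lemma wasserstein_partial mu nu (c : finsupp mu -> finsupp nu -> R) (e B : R) :
  (forall x y, 0 <= c x y) ->
  (forall x, \sum_y c x y <= mu (val x)) ->
  (forall y, \sum_x c x y <= nu (val y)) ->
  (forall x y, c x y != 0 -> mdist (val x) (val y) <= e) ->
  (forall x y, x \in finsupp mu -> y \in finsupp nu -> mdist x y <= B) -> 0 <= e ->
  wasserstein mu nu <= e + (1 - \sum_x \sum_y c x y) * B.
Proof.
move=> c0 c1 c2 ce dB e0; set m := \sum_x _.
pose a (x : finsupp mu) := mu (val x) - \sum_y c x y.
pose b (y : finsupp nu) := nu (val y) - \sum_x c x y.
have a0 x : 0 <= a x by rewrite subr_ge0.
have b0 y : 0 <= b y by rewrite subr_ge0.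
have sa : \sum_x a x = 1 - m by rewrite sumrB mass_sumT.
have sb : \sum_y b y = 1 - m by rewrite sumrB mass_sumT /m exchange_big.
have m1 : 0 <= 1 - m by rewrite -sa sumr_ge0.
(* If [1 - m = 0] the quotient is 0 by convention, but then nothing is left over and [a] vanishes
   too. The same holds for [b] below. *)
have am x : a x * (1 - m) / (1 - m) = a x.
  have [m10|m10] := eqVneq (1 - m) 0; last by rewrite mulfK.
  rewrite m10 mulr0 mul0r; apply/esym/eqP.
  by have /eqP := sa; rewrite m10 psumr_eq0 // => /allP/(_ x (mem_index_enum _)).
have bm y : b y * (1 - m) / (1 - m) = b y.
  have [m10|m10] := eqVneq (1 - m) 0; last by rewrite mulfK.
  rewrite m10 mulr0 mul0r; apply/esym/eqP.
  by have /eqP := sb; rewrite m10 psumr_eq0 // => /allP/(_ y (mem_index_enum _)).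
pose g x y := c x y + a x * b y / (1 - m).
have gg : coupling g.
  split=> [x y|x|y].
  - by rewrite addr_ge0 // mulr_ge0 ?invr_ge0 // mulr_ge0.
  - by rewrite big_split /= -mulr_suml -mulr_sumr sb am addrC subrK.
  - by rewrite big_split /= -!mulr_suml sa [(1 - m) * _]mulrC bm addrC subrK.
apply: (le_trans (wasserstein_le gg)).
apply: (@le_trans _ _ (\sum_x \sum_y (c x y * e + a x * b y / (1 - m) * B))).
  apply: ler_sum => x _; apply: ler_sum => y _; rewrite mulrDl lerD //.
    have [->|cxy] := eqVneq (c x y) 0; first by rewrite !mul0r.
    by rewrite ler_wpM2l // ce.
  by rewrite ler_wpM2l ?dB ?fsvalP // mulr_ge0 ?invr_ge0 // mulr_ge0.
under eq_bigr do rewrite big_split /= -!mulr_suml -mulr_sumr sb am.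
rewrite big_split /= -!mulr_suml -/m sa lerD2r.
by rewrite -[leRHS]mul1r ler_wpM2r // -subr_ge0.
Qed.

End Lipschitz.

(** * Wasserstein convergence tested on Lipschitz functions *)

Section Convergence.
Variable R : realType.

Lemma cvg_minr (T : Type) (F : set_system T) {FF : Filter F} (f g : T -> R) a b :
  f @ F --> a -> g @ F --> b -> Num.min (f t) (g t) @[t --> F] --> Num.min a b.
Proof.
move=> fa gb; rewrite minr_absE.
under eq_fun do rewrite minr_absE.
apply: cvgM; last exact: cvg_cst.
by apply: cvgB; [exact: cvgD|apply: cvg_norm; exact: cvgB].
Qed.

Lemma cvg_maxr (T : Type) (F : set_system T) {FF : Filter F} (f g : T -> R) a b :
  f @ F --> a -> g @ F --> b -> Num.max (f t) (g t) @[t --> F] --> Num.max a b.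
Proof.
move=> fa gb; rewrite maxr_absE.
under eq_fun do rewrite maxr_absE.
apply: cvgM; last exact: cvg_cst.
by apply: cvgD; [exact: cvgD|apply: cvg_norm; exact: cvgB].
Qed.

Lemma cvg_sumr (T : Type) (F : set_system T) {FF : Filter F} (J : Type) (r : seq J)
    (f : J -> T -> R) (a : J -> R) : (forall j, f j @ F --> a j) ->
  (fun t => \sum_(j <- r) f j t) @ F --> \sum_(j <- r) a j.
Proof. by move=> fa; apply: cvg_big => //; exact: add_continuous. Qed.

Lemma cvg_prodr (T : Type) (F : set_system T) {FF : Filter F} (J : Type) (r : seq J)
    (f : J -> T -> R) (a : J -> R) : (forall j, f j @ F --> a j) ->
  (fun t => \prod_(j <- r) f j t) @ F --> \prod_(j <- r) a j.
Proof. by move=> fa; apply: cvg_big => //; exact: mul_continuous. Qed.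

Lemma cvg_mdist (M : metricType R) (T : Type) (F : set_system T) {FF : Filter F}
    (f : T -> M) l :
  (forall e, 0 < e -> \forall t \near F, mdist l (f t) < e) <-> f @ F --> l.
Proof.
by split=> [fl|/cvg_ballP fl e e0]; [apply/cvg_ballP => e e0; have := fl e e0
  |have := fl e e0]; apply: filterS => t; rewrite ballEmdist.
Qed.

Variable X : metricType R.
Implicit Types (mu : finprob R X) (h : X -> R).

Lemma finite_separated (A : {fset X}) (e : R) : 0 < e -> exists r,
  [/\ 0 < r, r <= e & forall x y, x \in A -> y \in A -> x != y -> r <= mdist x y].
Proof.
move=> e0; pose r := \big[Num.min/e]_(p : A * A | val p.1 != val p.2)
  mdist (val p.1) (val p.2).
exists r; split.
- by apply: lt_bigmin => // -[x y] /=; rewrite mdist_gt0.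
- exact: bigmin_le_id.
- move=> x y xA yA xy.
  exact: (@bigmin_le_cond _ _ _ e ([` xA]%fset, [` yA]%fset)
    (fun p : A * A => val p.1 != val p.2) (fun p => mdist (val p.1) (val p.2))).
Qed.

Lemma expect_cvg (T : Type) (F : set_system T) {FF : Filter F}
    (nu : T -> finprob R X) mu h : unit_lipschitz h ->
  nu @ F --> mu -> expect (nu t) h @[t --> F] --> expect mu h.
Proof.
move=> [_ [L L0 hL]] /cvg_mdist numu; apply/cvgrPdist_lt => e e0.
have := numu (e / L); rewrite divr_gt0 // => /(_ isT).
apply: filterS => t; rewrite ltr_pdivlMr // mulrC.
exact/le_lt_trans/expect_wasserstein.
Qed.

Lemma bump_disjoint (x x' y : X) (r : R) : 0 < r -> 2 * r <= mdist x x' ->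
  0 < bump x r y -> bump x' r y = 0.
Proof.
move=> r0 xx' /(bump_gt0 r0) xy; apply/eqP; rewrite eq_le.
have [/(_ y)/andP[-> _] _] := unit_lipschitz_bump x' r0; rewrite andbT leNgt.
apply/negP => /(bump_gt0 r0) x'y; have := metric_triangle x y x'.
by rewrite (metric_sym y); lra.
Qed.

(* For bounded supports, convergence of the expectations of Lipschitz functions
   suffices: most of the mass near a point of the limit is transported to it. *)
Lemma wasserstein_cvg (T : Type) (F : set_system T) {FF : Filter F}
    (nu : T -> finprob R X) mu (B : R) :
  (\forall t \near F, forall x y, x \in finsupp mu -> y \in finsupp (nu t) ->
     mdist x y <= B) ->
  (forall h, unit_lipschitz h -> expect (nu t) h @[t --> F] --> expect mu h) ->
  nu @ F --> mu.
Proof.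
move=> nuB nuh; apply/cvg_mdist => e e0.
have e40 : 0 < e / 4 by rewrite divr_gt0.
have [r2 [r20 r2e r2sep]] := finite_separated (finsupp mu) e40.
pose r := r2 / 2; have r0 : 0 < r by rewrite divr_gt0.
have sep x x' : x \in finsupp mu -> x' \in finsupp mu -> x != x' ->
    2 * r <= mdist x x'.
  by move=> xm x'm xx'; rewrite (le_trans _ (r2sep _ _ xm x'm xx')) // /r; lra.
have bmu x : x \in finsupp mu -> expect mu (bump x r) = mu x.
  move=> xm; rewrite expectT (bigD1 [` xm]%fset) //= bumpxx mul1r big1 ?addr0 //.
  move=> y yx; rewrite (@bump_disjoint (val y)) ?mul0r ?bumpxx //.
  by apply: sep => //; rewrite ?fsvalP.
(* The mass of [nu t] that can be matched with atoms of [mu] at distance below [r]. It tends to 1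
   because the bumps separate the atoms. *)
pose k t := \sum_(x : finsupp mu) Num.min (expect (nu t) (bump (val x) r)) (mu (val x)).
have k1 : k @ F --> (1 : R).
  rewrite -(mass_sumT mu); apply: cvg_sumr => x.
  rewrite -{2}[mu (val x)]minxx; apply: cvg_minr; last exact: cvg_cst.
  by rewrite -[X in _ --> X]bmu ?fsvalP //; apply: nuh; exact: unit_lipschitz_bump.
have kB : (1 - k t) * B @[t --> F] --> (0 : R).
  rewrite -[X in _ --> X](mul0r B) -(subrr 1).
  by apply: cvgM; [apply: cvgB => //; exact: cvg_cst|exact: cvg_cst].
apply: filterS2 nuB (cvgr_lt _ kB _ e40) => t tB kt.
pose a x := expect (nu t) (bump x r).
have b0 x y : 0 <= bump x r y by have [/(_ y)/andP[]] := unit_lipschitz_bump x r0.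
have a0 x : 0 <= a x.
  by rewrite /a /expect sumr_ge0 // => y _; rewrite mulr_ge0 ?mass_ge0.
(* The factor that cuts the bump-weighted mass [a x] around [x] down to at most [mu x]. *)
pose q x := Num.min 1 (mu x / a x).
have q0 x : 0 <= q x by rewrite le_min ler01 divr_ge0 ?mass_ge0.
have q1 x : q x <= 1 by rewrite ge_min lexx.
have aq x : a x * q x = Num.min (a x) (mu x).
  have := a0 x; rewrite le_eqVlt => /predU1P[<-|ax]; first by rewrite mul0r min_l ?mass_ge0.
  by rewrite /q minr_pMr ?ltW // mulr1 mulrCA divff ?mulr1 ?gt_eqF.
pose c (x : finsupp mu) (y : finsupp (nu t)) :=
  bump (val x) r (val y) * nu t (val y) * q (val x).
have sc (x : finsupp mu) : \sum_y c x y = Num.min (a (val x)) (mu (val x)).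
  by rewrite -aq -mulr_suml -expectT.
apply: (@le_lt_trans _ _ (e / 4 + (1 - k t) * B)); last by rewrite /= in kt; lra.
rewrite (_ : k t = \sum_x \sum_y c x y); last by apply: eq_bigr => x _; rewrite sc.
apply: wasserstein_partial => //.
- by move=> x y; rewrite !mulr_ge0 ?mass_ge0.
- by move=> x; rewrite sc ge_min lexx orbT.
- move=> y; apply: (@le_trans _ _ (\sum_(x : finsupp mu)
      bump (val x) r (val y) * nu t (val y))).
    by apply: ler_sum => x _; rewrite ler_piMr // mulr_ge0 ?mass_ge0.
  rewrite -mulr_suml ler_piMl ?mass_ge0 //.
  have [[x bxy]|bx] := pselect (exists x : finsupp mu, 0 < bump (val x) r (val y)); last first.
    rewrite big1 // => x _; apply/eqP; rewrite eq_le b0 andbT leNgt.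
    by apply/negP => bxy; apply: bx; exists x.
  rewrite (bigD1 x) //= big1 ?addr0.
    by have [/(_ (val y))/andP[_ ->]] := unit_lipschitz_bump (val x) r0.
  move=> x' x'x; apply: (bump_disjoint r0 _ bxy); apply: sep; rewrite ?fsvalP //.
  by rewrite eq_sym.
- move=> x y; apply: contra_neqT; rewrite -ltNge => xy.
  rewrite /c (_ : bump _ _ _ = 0) ?mul0r //.
  apply/eqP; rewrite eq_le b0 andbT leNgt.
  by apply/negP => /(bump_gt0 r0); rewrite /r; lra.
- exact: ltW.
Qed.

End Convergence.

(** * The weak topology *)

Section WeakTopology.
Variables (R : realType) (V : choiceType) (K : simplicial_complex V).
Local Notation realization := (realization R K).

Lemma realization_inj (p q : realization) : bary p = bary q -> p = q.
Proof.
case: p q => [p Kp] [q Kq] /= e; move: Kp Kq; rewrite e => Kp Kq.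
by congr Realization; exact: Prop_irrelevance.
Qed.

Lemma cvg_ptws (S T : Type) (F : set_system T) {FF : Filter F}
    (f : T -> {ptws S -> R}) (l : {ptws S -> R}) :
  (forall i, (fun t => f t i) @ F --> l i) -> f @ F --> l.
Proof.
move=> fl; apply/cvg_sup => i U [W [[W' oW' <-] /= Wl] WU].
have FW : F ((fun t => f t i) @^-1` W') := fl i W' (open_nbhs_nbhs (conj oW' Wl)).
suff : F (f @^-1` U) by [].
by apply: filterS FW => t Wt; exact: WU.
Qed.

Lemma face_coords_inj (s : {fset V}) (p q : realization) :
  closed_face s p -> closed_face s q -> face_coords (s := s) p = face_coords q -> p = q.
Proof.
move=> ps qs pq; apply/realization_inj/finprobP => v.
have [vs|vs] := boolP (v \in s).
  exact: (congr1 (fun w : {ptws s -> R} => w [` vs]%fset) pq).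
by rewrite !fsfun_dflt //; apply: contra vs; [move: qs|move: ps] => /fsubsetP; apply.
Qed.

Lemma bary_continuous (v : V) : continuous (fun p : realization => p v).
Proof.
apply/continuousP => O oO.
suff : weak_open (K := K) ((fun p : realization => p v) @^-1` O) by [].
move=> s Ks; have [vs|vs] := boolP (v \in s).
  exists [set w : {ptws s -> R} | O (w [` vs]%fset)] => //.
  have pc : continuous (fun w : {ptws s -> R} => w [` vs]%fset).
    exact: (@proj_continuous s (fun=> R) [` vs]%fset).
  by move/continuousP : pc; apply.
have v0 p : closed_face s p -> p v = 0.
  by move=> /fsubsetP ps; rewrite fsfun_dflt //; apply: contra vs; exact: ps.
have [z0|z0] := pselect (O 0).
  exists setT; first exact: openT.
  by apply/seteqP; split=> p [sp _]; split=> //=; rewrite v0.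
exists set0; first exact: open0.
by apply/seteqP; split=> p [sp] //=; rewrite v0.
Qed.

(** Only finitely many supports [s] inside [A] are possible. If [s] contains the support of [p], the
    trace of the open set on the closed face of [s] settles the matter; otherwise a vertex outside
    [s] charged by [p] is eventually charged by [f t], whose support is then not [s]. *)
Lemma realization_cvg (T : Type) (F : set_system T) {FF : Filter F}
    (f : T -> realization) (p : realization) (A : {fset V}) :
  (\forall t \near F, (finsupp (f t) `<=` A)%fset) ->
  (forall v, f t v @[t --> F] --> p v) -> f @ F --> p.
Proof.
move=> fA fp W0; rewrite nbhsE => -[G [oG Gp] GW].
suff : \forall t \near F, forall s : fpowerset A, finsupp (f t) = val s -> G (f t).
  apply: filterS2 fA => t tA tO; apply: GW.
  have sA : finsupp (f t) \in fpowerset A by rewrite fpowersetE.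
  exact: (tO [` sA]%fset).
apply: filter_forall => -[s _] /=.
have [Ks|Ks] := pselect (simplex K s); last first.
  by apply: nearW => t fs; case: Ks; rewrite -fs; exact: bary_simplex.
have [ps|ps] := boolP (finsupp p `<=` s)%fset.
  have [W oW GWE] := oG s Ks.
  have Wp : W (face_coords p).
    have : (closed_face s `&` G) p by split.
    by rewrite GWE => -[].
  have FW : F [set t | W (face_coords (f t))] := @cvg_ptws _ _ F FF
    (fun t => face_coords (s := s) (f t)) (face_coords p)
    (fun i => fp _) W (open_nbhs_nbhs (conj oW Wp)).
  apply: filterS FW => t Wt fs.
  have : (closed_face s `&` (@face_coords _ _ _ s) @^-1` W) (f t).
    by split=> //; rewrite /closed_face /= fs.
  by rewrite -GWE => -[].
have [v vp vs] : exists2 v, v \in finsupp p & v \notin s.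
  by move/fsubsetPn: ps => [v vp vs]; exists v.
have Fv : \forall t \near F, 0 < f t v by apply: (cvgr_gt (p v)) => //; exact/mass_gt0P.
apply: filterS Fv => t /mass_gt0P vt fs.
by move: vs; rewrite -fs vt.
Qed.

(* Points p_v of C with v in the support of p_v form a closed discrete set, since
   a simplex contains only finitely many of them. *)
Lemma compact_finite_support (C : set realization) : compact C ->
  exists A : {fset V}, forall p, C p -> (finsupp p `<=` A)%fset.
Proof.
move=> cC; have [[p0 Cp0]|C0] := pselect (exists p, C p); last first.
  by exists fset0 => p Cp; case: C0; exists p.
pose S v := exists2 p, C p & v \in finsupp p.
have [q qP] : {q : V -> realization & forall v, C (q v) /\ (S v -> v \in finsupp (q v))}.
  apply: (@choice _ _ (fun v p => C p /\ (S v -> v \in finsupp p))) => v.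
  have [[p Cp vp]|Sv] := pselect (S v); first by exists p.
  by exists p0; split=> // /Sv.
pose P := q @` S.
(* A closed face meets this set only in points [q v] with [v] in [s]. These are finitely many, hence
   closed in the Hausdorff space of coordinates. *)
have oP x : open (~` (P `\ x)).
  suff : weak_open (K := K) (~` (P `\ x)) by [].
  move=> s Ks; pose Q := q @` [set v | [/\ v \in s, S v, q v <> x & closed_face s (q v)]].
  exists (~` (@face_coords _ _ _ s @` Q)).
    apply: closed_openC; apply: (@accessible_finite_set_closed {ptws s -> R}).1.
      apply: hausdorff_accessible; apply: hausdorff_product => _; exact: Rhausdorff.
    do 2!apply: finite_image; apply: (sub_finite_set (B := [set` s])) => [v []//|].
    exact: finite_fset.
  apply/seteqP; split=> p [sp Pp]; split=> //.
    move=> [_ [v [vs Sv qx qs] <-]] /face_coords_inj e; apply: Pp.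
    by rewrite -e //; split=> //; exists v.
  move=> [[v Sv qp] px]; apply: Pp; exists p => //; exists v => //.
  split=> //; [|by rewrite qp|by rewrite qp].
  by move/fsubsetP: sp; apply; rewrite -qp; have [_ /(_ Sv)] := qP v.
(* Finite sets directed by inclusion: the near-covering form of compactness provides a single finite
   set [E] containing [P]. *)
pose F := filter_from [set: {fset realization}] (fun E => [set E' | (E `<=` E')%fset]).
have FF : Filter F.
  apply: filter_fromT_filter; first by exists fset0.
  by move=> E E'; exists (E `|` E')%fset => A /=; rewrite fsubUset => /andP[].
have /compact_near_coveringP/(_ _ F (fun E p => P p -> p \in E) FF) := cC.
case=> [x Cx|E _ /(_ E (fsubset_refl E)) PE].
  exists (~` (P `\ x), [set E | [fset x]%fset `<=` E]%fset); first split.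
  - by apply: open_nbhs_nbhs; split=> [|[_]]; [exact: oP|apply].
  - by exists [fset x]%fset.
  move=> [y E] /= [Py xE] PPy; have [->|yx] := pselect (y = x).
    by move/fsubsetP: xE; apply; rewrite inE.
  by case: Py; split.
exists (\bigcup_(p <- E) finsupp p)%fset => p Cp; apply/fsubsetP => v vp.
have Sv : S v by exists p.
have [Cq /(_ Sv) vq] := qP v.
apply/bigfcupP; exists (q v) => //; rewrite andbT.
by apply: PE => //; exists v.
Qed.

End WeakTopology.

(** * Grids in the cube *)

Section Grid.
Variables (R : realType) (n : nat).
Local Notation cube := (@cube R n).

Lemma row_norm_lt (x : 'rV[R]_n) (r : R) :
  0 < r -> (forall i, `|x ord0 i| < r) -> `|x| < r.
Proof.
move=> r0 xr; rewrite [ltLHS]mx_normrE; apply: bigmax_lt => // -[i j] _ /=.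
by rewrite ord1.
Qed.

Lemma row_norm_coord (x : 'rV[R]_n) i : `|x ord0 i| <= `|x|.
Proof.
rewrite [leRHS]mx_normrE.
exact: (le_bigmax_cond 0 (fun p : 'I_1 * 'I_n => `|x p.1 p.2|) (j := (ord0, i))).
Qed.

Lemma compact_cube : compact cube.
Proof.
apply: bounded_closed_compact; last exact: closed_cube.
exists 1; split=> [|M M1 t tc]; first exact: num_real.
apply: ltW; apply: row_norm_lt => [|i]; first exact: lt_trans M1.
by have /andP[? ?] := tc i; rewrite ger0_norm //; exact: le_lt_trans M1.
Qed.

Let plateau (y : R) := Num.max 0 (Num.min 1 (3 - y)).
Let tent (y : R) := Num.max 0 (1 - y).

Let plateau1 y : y <= 2 -> plateau y = 1.
Proof. by move=> y2; rewrite /plateau min_l ?max_r //; lra. Qed.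

Let plateau_neq0 y : plateau y != 0 -> y < 3.
Proof.
move=> py; rewrite ltNge; apply: contra_neqN py => y3.
by rewrite /plateau max_l // ge_min; apply/orP; right; lra.
Qed.

Let plateau01 y : 0 <= plateau y <= 1.
Proof. by rewrite /plateau le_max lexx ge_max ler01 ge_min lexx. Qed.

Let tent_gt0 y : (0 < tent y) = (y < 1).
Proof. by rewrite /tent lt_max ltxx subr_gt0. Qed.

Let sub_cont (a : R) : continuous (fun y : R => a - y).
Proof. by move=> y; apply: cvgB; [exact: cvg_cst|exact: cvg_id]. Qed.

Let plateau_cont : continuous plateau.
Proof.
move=> y; apply: cvg_maxr; first exact: cvg_cst.
by apply: cvg_minr; [exact: cvg_cst|exact: sub_cont].
Qed.

Let tent_cont : continuous tent.
Proof. by move=> y; apply: cvg_maxr; [exact: cvg_cst|exact: sub_cont]. Qed.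

(** The Lebesgue number lemma. The radius is three meshes of the grid of spacing [1 / m.+1], to fit
    the supports of the cut-offs [lam] below. *)
Lemma cube_lebesgue (W : 'rV[R]_n -> set 'rV[R]_n) :
  (forall c, cube c -> nbhs c (W c)) ->
  exists m : nat, forall t, cube t ->
    exists2 c, cube c & forall u, `|t - u| < 3 / m.+1%:R -> W c u.
Proof.
move=> nW; pose P (m : nat) t := exists2 c, cube c &
  forall u, `|t - u| < 3 / m.+1%:R -> W c u.
have /compact_near_coveringP/(_ _ \oo P _) := compact_cube.
case=> [x Cx|m _ /(_ m (leqnn m)) Pm]; last by exists m.
have /nbhs_ballP[e /= e0 eW] := nW x Cx.
(* Half of [e] is spent on moving the centre; three meshes below [e / 6] fit into the other half. *)
have e60 : 0 < e / 6 by rewrite divr_gt0.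
exists (ball x (e / 2), [set m : nat | m.+1%:R^-1 < e / 6]).
  split; first by apply: nbhsx_ballx; rewrite divr_gt0.
  exact: (near_infty_natSinv_lt (PosNum e60)).
move=> [y m] [/=]; rewrite -ball_normE /= => xy me; exists x => // u yu.
apply: eW; rewrite -ball_normE /=.
apply: (le_lt_trans (ler_distD y _ _)).
have m3 : 3 / m.+1%:R < 3 * (e / 6) by rewrite ltr_pM2l.
by apply: (lt_le_trans (ltrD xy (lt_trans yu m3))); lra.
Qed.

(* [p] enumerates a grid of small mesh; [lam j] and [hat j] are cut-offs around
   [p j], of radius 3 meshes (with a plateau of radius 2) and 1 mesh. The bound
   [7 ^ n] does not depend on the mesh, hence not on [W]. *)
Lemma grid_partition (W : 'rV[R]_n -> set 'rV[R]_n) :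
  (forall c, cube c -> nbhs c (W c)) ->
  exists (J : finType) (c p : J -> 'rV[R]_n) (lam hat : J -> 'rV[R]_n -> R),
  [/\ (forall j, cube (c j) /\ cube (p j)) /\
        (forall j, continuous (lam j) /\ continuous (hat j)),
      forall j t, 0 <= lam j t <= 1 /\ 0 <= hat j t,
      forall t, cube t -> (#|[set j | lam j t != 0%R]%SET| <= 7 ^ n)%N,
      forall j t, lam j t != 0 -> W (c j) t &
      forall t, cube t -> exists j, [/\ lam j t = 1, 0 < hat j t &
        forall i, 0 < hat i t -> lam j (p i) = 1]].
Proof.
move=> /cube_lebesgue[m mW]; pose k : R := m.+1%:R.
have k0 : 0 < k by rewrite ltr0n.
pose J := {ffun 'I_n -> 'I_m.+2}.
pose g (j : J) : 'rV[R]_n := \row_i (j i)%:R.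
pose p j := k^-1 *: g j.
have gp j : k *: p j = g j by rewrite /p scalerA divff ?scale1r // gt_eqF.
have cp j : cube (p j).
  move=> i; rewrite !mxE mulr_ge0 ?invr_ge0 ?ler0n //= mulrC ler_pdivrMr //.
  by rewrite mul1r ler_nat -ltnS.
have [c cW] : {c : J -> 'rV[R]_n & forall j, cube (c j) /\
    forall u, `|p j - u| < 3 / k -> W (c j) u}.
  apply: (@choice _ _ (fun j c => cube c /\ forall u, `|p j - u| < 3 / k -> W c u)) => j.
  by have [c cc cW] := mW _ (cp j); exists c.
have dist_cont j : continuous (fun t : 'rV[R]_n => `|k *: t - g j| : R).
  have affc : continuous (fun t : 'rV[R]_n => k *: t - g j).
    apply: continuous_row => i.
    rewrite (_ : (fun t => _) = fun t : 'rV[R]_n => k * t ord0 i + - (j i)%:R).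
      by apply: continuous_affine; exact: coord_continuous.
    by apply/funext => t; rewrite !mxE.
  exact: (continuous_compT affc (@norm_continuous _ 'rV[R]_n)).
exists J, c, p, (fun j t => plateau `|k *: t - g j|), (fun j t => tent `|k *: t - g j|).
split.
- split=> j; first by split=> //; have [] := cW j.
  by split; apply: (continuous_compT (dist_cont j)); [exact: plateau_cont|exact: tent_cont].
- by move=> j t; split=> //; rewrite le_max lexx.
- move=> t ct.
  (* In each coordinate, the relevant indices lie within 3 of [k * t ord0 i], hence among the 7
     integers from [a i] on; [f] records the offsets. *)
  pose a i : nat := Num.truncn (k * t ord0 i - 3).
  pose f (j : J) : {ffun 'I_n -> 'I_7} := [ffun i => inord (j i - a i)].
  have aP (j : J) i : plateau `|k *: t - g j| != 0 -> (a i <= j i)%N /\ (j i - a i < 7)%N.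
    move=> /plateau_neq0 /(le_lt_trans (row_norm_coord _ i)).
    rewrite !mxE ltr_norml => /andP[l u].
    have aj : (a i <= j i)%N.
      by rewrite /a truncn_le_nat -natr1; lra.
    split=> //; rewrite ltn_subLR // -(ltr_nat R) natrD.
    have := truncnS_gt (k * t ord0 i - 3); rewrite -/(a i) -natr1; lra.
  rewrite -[7%N]card_ord -[n in (_ ^ n)%N]card_ord -card_ffun.
  apply: (@leq_card_in _ _ f) => i j; rewrite !inE => Hi Hj /ffunP ij.
  apply/ffunP => u; apply/val_inj => /=.
  have [ai ai7] := aP i u Hi; have [aj aj7] := aP j u Hj.
  have := congr1 val (ij u); rewrite !ffunE /= !inordK // => e.
  by rewrite -(subnK ai) e subnK.
- move=> j t /plateau_neq0 jt; have [_] := cW j; apply.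
  rewrite ltr_pdivlMr // mulrC -[X in X * _](gtr0_norm k0) -normrZ.
  by rewrite scalerBr gp distrC.
- move=> t ct.
  have kt i : 0 <= k * t ord0 i by have /andP[? _] := ct i; rewrite mulr_ge0 // ltW.
  (* The grid point obtained by rounding [t] down is less than one mesh away from [t]. Any grid
     point whose hat is positive at [t] is thus within two meshes of it, on its plateau. *)
  pose j : J := [ffun i => inord (Num.truncn (k * t ord0 i))].
  have jt : `|k *: t - g j| < 1.
    apply: row_norm_lt => // i; rewrite !mxE ffunE inordK.
      have /andP[] := truncn_itv (kt i); rewrite -natr1 => l u.
      by rewrite ltr_norml; apply/andP; split; lra.
    rewrite ltnS truncn_le_nat -[_.+2%:R]natr1 ltr_pwDr //.
    have /andP[_ t1] := ct i.
    by rewrite -[leRHS]mulr1 ler_wpM2l // ltW.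
  exists j; split; [by apply: plateau1; lra|by rewrite tent_gt0|].
  move=> i; rewrite tent_gt0 gp => it; apply: plateau1.
  apply: (le_trans (ler_distD (k *: t) _ _)).
  by rewrite (distrC _ (k *: t)); lra.
Qed.

End Grid.

(** * Mixtures *)

Section Mixtures.
Variables (R : realType) (V : choiceType).
Implicit Types (mu nu : finprob R V) (h : V -> R).

Lemma finsuppE mu v : (v \in finsupp mu) = (mu v != 0).
Proof. exact: mem_finsupp. Qed.

Lemma finprob_reweight mu h : (forall v, 0 <= h v) -> 0 < expect mu h ->
  exists nu : finprob R V, forall v, nu v = h v * mu v / expect mu h.
Proof.
move=> h0 e0; apply: (@finprob_of_mass _ _ (finsupp mu)) => [v|v vmu|].
- by apply: divr_ge0; [rewrite mulr_ge0 ?mass_ge0|exact: ltW].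
- by rewrite fsfun_dflt // mulr0 mul0r.
- by rewrite -mulr_suml divff // gt_eqF.
Qed.

Lemma finprob_points (J : finType) (x : J -> V) (q : J -> R) :
  (forall j, 0 <= q j) -> \sum_j q j = 1 ->
  exists nu : finprob R V, forall v, nu v = \sum_j (x j == v)%:R * q j.
Proof.
move=> q0 q1; apply: (@finprob_of_mass _ _ [fset x j | j in J]%fset) => [v|v vx|].
- by apply: sumr_ge0 => j _; rewrite mulr_ge0 ?ler0n.
- rewrite big1 // => j _; rewrite (_ : (x j == v) = false) ?mul0r //.
  by apply: contraNF vx => /eqP <-; apply/imfsetP; exists j.
- rewrite exchange_big -[RHS]q1 /=; apply: eq_bigr => j _.
  rewrite -mulr_suml (big_fsetD1 (x j)) /=; last by apply/imfsetP; exists j.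
  rewrite eqxx /= [X in 1 + X]big1_seq ?addr0 ?mul1r // => v /= /fsetD1P[vx _].
  by rewrite eq_sym (negbTE vx).
Qed.

Lemma finprob_mix mu1 mu2 mu3 (a b c : R) : 0 <= a -> 0 <= b -> 0 <= c ->
  a + b + c = 1 -> exists nu : finprob R V,
    forall v, nu v = a * mu1 v + b * mu2 v + c * mu3 v.
Proof.
move=> a0 b0 c0 abc.
pose A := (finsupp mu1 `|` finsupp mu2 `|` finsupp mu3)%fset.
apply: (@finprob_of_mass _ _ A) => [v|v|].
- by rewrite !addr_ge0 // mulr_ge0 ?mass_ge0.
- rewrite !inE !negb_or => /andP[/andP[v1 v2] v3].
  by rewrite !fsfun_dflt // !mulr0 !addr0.
- rewrite !big_split -!mulr_sumr /= !mass_sum_sub ?mulr1 //.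
  + exact: fsubsetUr.
  + exact: fsubset_trans (fsubsetUr _ _) (fsubsetUl _ _).
  + exact: fsubset_trans (fsubsetUl _ _) (fsubsetUl _ _).
Qed.

Lemma expect_reweight mu h nu h' : (forall v, nu v = h v * mu v / expect mu h) ->
  0 < expect mu h ->
  expect nu h' = expect mu (fun v => h' v * h v) / expect mu h :> R.
Proof.
move=> nuE e0; rewrite (@expect_sub _ _ nu _ (finsupp mu)); last first.
  apply/fsubsetP => v; rewrite !finsuppE nuE; apply: contra => /eqP ->.
  by rewrite mulr0 mul0r.
by rewrite {1}/expect mulr_suml; apply: eq_bigr => v _; rewrite nuE !mulrA.
Qed.

Lemma expect_points (J : finType) (x : J -> V) (q : J -> R) nu h :
  (forall v, nu v = \sum_j (x j == v)%:R * q j) ->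
  expect nu h = \sum_j h (x j) * q j :> R.
Proof.
move=> nuE; rewrite (@expect_sub _ _ nu _ [fset x j | j in J]%fset); last first.
  apply/fsubsetP => v; rewrite finsuppE nuE; apply: contraR => vx.
  rewrite big1 // => j _; rewrite (_ : (x j == v) = false) ?mul0r //.
  by apply: contraNF vx => /eqP <-; apply/imfsetP; exists j.
under eq_bigr do rewrite nuE mulr_sumr.
rewrite exchange_big /=; apply: eq_bigr => j _.
rewrite (big_fsetD1 (x j)) /=; last by apply/imfsetP; exists j.
rewrite eqxx mul1r [X in _ + X]big1_seq ?addr0 // => v /= /fsetD1P[vx _].
by rewrite eq_sym (negbTE vx) mul0r mulr0.
Qed.

Lemma expect_mix mu1 mu2 mu3 (a b c : R) nu h :
  (forall v, nu v = a * mu1 v + b * mu2 v + c * mu3 v) ->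
  expect nu h = a * expect mu1 h + b * expect mu2 h + c * expect mu3 h.
Proof.
move=> nuE; pose A := (finsupp mu1 `|` finsupp mu2 `|` finsupp mu3)%fset.
rewrite (@expect_sub _ _ nu _ A); last first.
  apply/fsubsetP => v; rewrite finsuppE nuE; apply: contraR.
  rewrite !inE !negb_or => /andP[/andP[v1 v2] v3].
  by rewrite !fsfun_dflt // !mulr0 !addr0.
rewrite (@expect_sub _ _ mu1 _ A) ?(@expect_sub _ _ mu2 _ A) ?(@expect_sub _ _ mu3 _ A).
- rewrite !mulr_sumr -!big_split /=; apply: eq_bigr => v _.
  by rewrite nuE; ring.
- exact: fsubsetUr.
- exact: fsubset_trans (fsubsetUr _ _) (fsubsetUl _ _).
- exact: fsubset_trans (fsubsetUl _ _) (fsubsetUl _ _).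
Qed.

End Mixtures.

(** * Functions continuous on a subset *)

Section WithinContinuous.
Variables (R : realType) (T : topologicalType) (D : set T).
Implicit Types f g : T -> R.

Lemma within_cst (a : R) : {within D, continuous (fun=> a : R)}.
Proof. by move=> x; exact: cvg_cst. Qed.

Lemma within_add f g : {within D, continuous f} -> {within D, continuous g} ->
  {within D, continuous (fun x => f x + g x)}.
Proof. by move=> fc gc x; apply: cvgD; [exact: fc|exact: gc]. Qed.

Lemma within_mul f g : {within D, continuous f} -> {within D, continuous g} ->
  {within D, continuous (fun x => f x * g x)}.
Proof. by move=> fc gc x; apply: cvgM; [exact: fc|exact: gc]. Qed.

Lemma within_sum (J : Type) (r : seq J) (f : J -> T -> R) :
  (forall j, {within D, continuous (f j)}) ->
  {within D, continuous (fun x => \sum_(j <- r) f j x)}.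
Proof. by move=> fc x; apply: cvg_sumr => j; exact: fc. Qed.

Lemma within_prod (J : Type) (r : seq J) (f : J -> T -> R) :
  (forall j, {within D, continuous (f j)}) ->
  {within D, continuous (fun x => \prod_(j <- r) f j x)}.
Proof. by move=> fc x; apply: cvg_prodr => j; exact: fc. Qed.

Lemma within_div f g : (forall x, D x -> g x != 0) ->
  {within D, continuous f} -> {within D, continuous g} ->
  {within D, continuous (fun x => f x / g x)}.
Proof.
move=> g0 /subspace_continuousP fc /subspace_continuousP gc.
apply/subspace_continuousP => x Dx; apply: cvgM; first exact: fc.
by apply: cvgV; [exact: g0|exact: gc].
Qed.

Lemma within_eq (S : topologicalType) (f g : T -> S) :
  (forall x, D x -> f x = g x) -> {within D, continuous f} -> {within D, continuous g}.
Proof. by move=> fg; apply: subspace_eq_continuous => x /set_mem /fg. Qed.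

Lemma within_sub (S : topologicalType) (E : set T) (f : T -> S) : D `<=` E ->
  {within E, continuous f} -> {within D, continuous f}.
Proof.
by move=> DE; apply: (within_comp_sub (g := id)) => // x; exact: cvg_id.
Qed.

End WithinContinuous.

(** * The thickening and the complex *)

Section Thickening.
Variables (R : realType) (X : metricType R) (I : Type) (U : I -> set X).
Local Notation Y := (set_type (vietoris_thickening U)).
Local Notation Y' := (realization R (vietoris_complex U)).

Lemma thickening_simplex (y : Y) : simplex (vietoris_complex U) (finsupp (set_val y)).
Proof.
split; last by have /set_mem := valP y.
by have [v vy] := finsupp_neq0 (set_val y); apply/fset0Pn; exists v.
Qed.

Definition to_complex (y : Y) : Y' := Realization (thickening_simplex y).

Lemma complex_thickening (p : Y') : bary p \in vietoris_thickening U.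
Proof. by apply/mem_set; have [] := bary_simplex p. Qed.

Definition to_thickening (p : Y') : Y := SigSub (complex_thickening p).

Lemma to_complexK : cancel to_complex to_thickening.
Proof. by move=> y; exact: val_inj. Qed.

Lemma to_thickeningK : cancel to_thickening to_complex.
Proof. by move=> p; exact: realization_inj. Qed.

Hypothesis bndU : uniformly_bounded U.

Lemma uniform_bound : exists2 D : R, 0 <= D &
  forall i x y, U i x -> U i y -> mdist x y <= D.
Proof.
have [D Ddiam] := bndU; exists (Num.max 0 D); first by rewrite le_max lexx.
move=> i x y Ux Uy; rewrite le_max; apply/orP; right.
rewrite -lee_fin (le_trans _ (ltW (Ddiam i))) //.
by apply: ereal_sup_ubound; exists x => //; exists y.
Qed.

(** If all pairs of support points were at distance at least [r], every coupling would cost at least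
    [r]. *)
Lemma wasserstein_close (mu nu : finprob R X) (r : R) : wasserstein mu nu < r ->
  exists x y, [/\ x \in finsupp mu, y \in finsupp nu & mdist x y < r].
Proof.
move=> mnr; apply: contrapT => far.
suff : r <= wasserstein mu nu by rewrite leNgt mnr.
apply: le_wasserstein => c [c0 c1 _].
have -> : r = \sum_x \sum_y c x y * r.
  under eq_bigr do rewrite -mulr_suml c1.
  by rewrite -mulr_suml mass_sumT mul1r.
apply: ler_sum => x _; apply: ler_sum => y _; rewrite ler_wpM2l // leNgt.
by apply/negP => xy; apply: far; exists (val x), (val y); rewrite !fsvalP.
Qed.

Lemma thickening_expect (T : topologicalType) (D : set T) (f : T -> Y) h :
  unit_lipschitz h -> {within D, continuous f} ->
  {within D, continuous (fun t => expect (set_val (f t)) h)}.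
Proof.
move=> hL fc x; have /cvg_mdist fx := fc x.
by apply: expect_cvg => //; apply/cvg_mdist => e /fx.
Qed.

(** Bounded test functions alone do not prevent a little mass from escaping far away at a high cost;
    the local bound on the distance of supports does, so that [wasserstein_cvg] applies. *)
Lemma thickening_bounded_continuous (T : topologicalType) (A : set T) (f : T -> Y) :
  (forall t, A t -> exists B : R, \forall t' \near within A (nbhs t),
    forall x y, x \in finsupp (set_val (f t)) -> y \in finsupp (set_val (f t')) ->
    mdist x y <= B) ->
  (forall h, unit_lipschitz h ->
    {within A, continuous (fun t => expect (set_val (f t)) h)}) ->
  {within A, continuous f}.
Proof.
move=> fB fh; apply/subspace_continuousP => t At.
suff fW : set_val (f t') @[t' --> within A (nbhs t)] --> (set_val (f t) : finprob R X).
  by apply/cvg_mdist => e e0; exact: (cvg_mdist _ _).2 fW e e0.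
have [B tB] := fB t At; apply: (wasserstein_cvg tB).
by move=> h /fh /subspace_continuousP; apply.
Qed.

(* Here [f] is only required to stay at bounded distance of a continuous map [g]. *)
Lemma thickening_continuous (T S : topologicalType) (A : set T) (E : set S)
    (f : T -> Y) (p : T -> S) (g : S -> Y) (D : R) :
  (forall t, A t -> E (p t)) -> continuous p -> {within E, continuous g} ->
  (forall t y, A t -> y \in finsupp (set_val (f t)) ->
    exists2 x, x \in finsupp (set_val (g (p t))) & mdist x y <= D) ->
  (forall h, unit_lipschitz h ->
    {within A, continuous (fun t => expect (set_val (f t)) h)}) ->
  {within A, continuous f}.
Proof.
move=> AE pc gc fg; have [D' D'0 diamU] := uniform_bound.
have gpc : {within A, continuous (g \o p)} by exact: within_comp_sub gc.
(* The route from [x] to [y]: [D] to the support of [g (p t)], [D'] inside it, 1 across to the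
   support of [g (p t')], then [D'] and [D] again. *)
apply: thickening_bounded_continuous => t At; exists (D + D' + 1 + D' + D).
move/subspace_continuousP/(_ t At)/cvg_mdist/(_ _ ltr01) : gpc.
have Awithin : \forall t' \near within A (nbhs t), A t' by exact: withinT.
apply: filterS2 Awithin => t' At' /= /wasserstein_close[x0 [y0 [x0g y0g xy0]]] x y xf yf.
have [x1 x1g xx1] := fg _ _ At xf; have [y1 y1g yy1] := fg _ _ At' yf.
have diamg s u v : u \in finsupp (set_val (g s)) -> v \in finsupp (set_val (g s)) ->
    mdist u v <= D'.
  have [i sU] : vietoris_thickening U (set_val (g s)) by apply/set_mem/valP.
  by move=> us vs; apply: (diamU i); exact: sU.
have := metric_triangle x x1 y; have := metric_triangle x1 x0 y.
have := metric_triangle x0 y0 y; have := metric_triangle y0 y1 y.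
have := diamg _ _ _ x0g x1g; have := diamg _ _ _ y0g y1g.
by rewrite (metric_sym x0 x1) (metric_sym x x1); lra.
Qed.

Lemma to_complex_coord (T : topologicalType) (D : set T) (f : T -> Y) v :
  {within D, continuous (to_complex \o f)} ->
  {within D, continuous (fun t => set_val (f t) v)}.
Proof.
move=> fc x; exact: (continuous_comp (fc x) (@bary_continuous R X _ v _)).
Qed.

Lemma to_complex_continuous (T : topologicalType) (D : set T) (f : T -> Y)
    (A : {fset X}) :
  (forall t, D t -> (finsupp (set_val (f t)) `<=` A)%fset) ->
  (forall v, {within D, continuous (fun t => set_val (f t) v)}) ->
  {within D, continuous (to_complex \o f)}.
Proof.
move=> fA fc; apply/subspace_continuousP => t Dt.
apply: (@realization_cvg _ _ _ _ _ _ _ _ A).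
  have := withinT D (nbhs_filter t); apply: filterS => t' /=; exact: fA.
by move=> v; move/subspace_continuousP : (fc v); apply.
Qed.

Lemma to_complex_finite_support (T : topologicalType) (D : set T) (f : T -> Y) :
  compact D -> {within D, continuous (to_complex \o f)} ->
  exists A : {fset X}, forall t, D t -> (finsupp (set_val (f t)) `<=` A)%fset.
Proof.
move=> cD fc; have [A AP] := compact_finite_support (continuous_compact fc cD).
by exists A => t Dt; apply: (AP (to_complex (f t))); exists t.
Qed.

(** Compactness confines all supports to one finite set. Their mutual distances are then bounded,
    and expectations are finite sums of continuous barycentric coordinates. *)
Lemma to_thickening_continuous (T : topologicalType) (D : set T) (f : T -> Y) :
  compact D -> {within D, continuous (to_complex \o f)} -> {within D, continuous f}.
Proof.
move=> cD fc; have [A AP] := to_complex_finite_support cD fc.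
apply: thickening_bounded_continuous => [t Dt|h _].
  exists (\sum_(p : A * A) mdist (val p.1) (val p.2)).
  have := withinT D (nbhs_filter t); apply: filterS => t' /= Dt' x y xf yf.
  have xA := fsubsetP (AP _ Dt) x xf; have yA := fsubsetP (AP _ Dt') y yf.
  rewrite (bigD1 ([` xA]%fset, [` yA]%fset)) //= lerDl.
  by apply: sumr_ge0 => p _; exact: mdist_ge0.
apply: (within_eq (f := fun t => \sum_(v <- A) h v * set_val (f t) v)).
  by move=> t /AP tA; rewrite (expect_sub h tA).
apply: within_sum => v; apply: within_mul; first exact: within_cst.
exact: to_complex_coord fc.
Qed.

End Thickening.

(** * Coefficients of the two-stage linear homotopy *)

Section MixCoefficients.
Variable R : realType.

(** The Weierstrass product inequality, used as a union bound: the mass lost to a product of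
    cut-offs is at most the sum of the separate losses. *)
Lemma prod_1B_ge (J : Type) (r : seq J) (a : J -> R) : (forall j, 0 <= a j <= 1) ->
  1 - \sum_(j <- r) a j <= \prod_(j <- r) (1 - a j).
Proof.
move=> a01; elim: r => [|j r IH]; first by rewrite !big_nil subr0.
rewrite !big_cons; have /andP[a0 a1] := a01 j.
have s0 : 0 <= \sum_(i <- r) a i by apply: sumr_ge0 => i _; case/andP: (a01 i).
have : (1 - a j) * (1 - \sum_(i <- r) a i) <= (1 - a j) * \prod_(i <- r) (1 - a i).
  by rewrite ler_wpM2l // subr_ge0.
by nra.
Qed.

(** Piecewise linear weights of three measures: all the weight is on the first at time 0, on the
    second at time 1/2 and on the third at time 1. *)
Definition mix0 (s : R) : R := Num.max 0 (1 - 2 * s).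
Definition mix2 (s : R) : R := Num.max 0 (2 * s - 1).
Definition mix1 (s : R) : R := 1 - mix0 s - mix2 s.

Lemma mix_ge0 s : 0 <= s <= 1 -> [/\ 0 <= mix0 s, 0 <= mix1 s & 0 <= mix2 s].
Proof.
move=> /andP[s0 s1]; rewrite /mix1 /mix0 /mix2 !le_max !lexx /=; split=> //.
by rewrite !maxEle; case: ifPn => h1; case: ifPn => h2; lra.
Qed.

Lemma mix_sum s : mix0 s + mix1 s + mix2 s = 1.
Proof. by rewrite /mix1; ring. Qed.

(** The three measures are never mixed all at once, so only consecutive ones must have their
    supports in a common set of the cover. *)
Lemma mix_cases s : mix2 s = 0 \/ mix0 s = 0.
Proof.
rewrite /mix0 /mix2; have [s2|s2] := leP s (1 / 2).
  by left; rewrite max_l //; lra.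
by right; rewrite max_l //; lra.
Qed.

Lemma mix_at0 : [/\ mix0 0 = 1, mix1 0 = 0 & mix2 0 = 0].
Proof.
have e0 : mix0 0 = 1 by rewrite /mix0 max_r; lra.
have e2 : mix2 0 = 0 by rewrite /mix2 max_l //; lra.
by rewrite /mix1 e0 e2; split=> //; ring.
Qed.

Lemma mix_at1 : [/\ mix0 1 = 0, mix1 1 = 0 & mix2 1 = 1].
Proof.
have e0 : mix0 1 = 0 by rewrite /mix0 max_l //; lra.
have e2 : mix2 1 = 1 by rewrite /mix2 max_r; lra.
by rewrite /mix1 e0 e2; split=> //; ring.
Qed.

Lemma mix_continuous : [/\ continuous mix0, continuous mix1 & continuous mix2].
Proof.
have idc : continuous (@id R) by move=> x; exact: cvg_id.
have c0 : continuous mix0.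
  move=> s; apply: cvg_maxr; first exact: cvg_cst.
  by apply: cvgB; [exact: cvg_cst|apply: continuous_scale].
have c2 : continuous mix2.
  move=> s; apply: cvg_maxr; first exact: cvg_cst.
  by apply: cvgB; [apply: continuous_scale|exact: cvg_cst].
split=> // s; apply: cvgB; last exact: c2.
by apply: cvgB; [exact: cvg_cst|exact: c0].
Qed.

Lemma mix_within (S : topologicalType) (E : set S) (e0 e1 e2 : S -> R) :
  {within E, continuous e0} -> {within E, continuous e1} ->
  {within E, continuous e2} ->
  {within `[0, 1] `*` E, continuous (fun z : R * S =>
     mix0 z.1 * e0 z.2 + mix1 z.1 * e1 z.2 + mix2 z.1 * e2 z.2)}.
Proof.
have sndc e : {within E, continuous e} ->
    {within `[0, 1] `*` E, continuous (fun z : R * S => e z.2 : R)}.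
  by apply: (within_comp_sub (g := snd)) => [z [] //|]; exact: continuous_snd.
have fstc (a : R -> R) : continuous a ->
    {within `[0, 1] `*` E, continuous (fun z : R * S => a z.1)}.
  move=> ac; apply: continuous_subspaceT.
  exact: (continuous_compT (@continuous_fst R S) ac).
have [c0 c1 c2] := mix_continuous.
move=> /sndc ec0 /sndc ec1 /sndc ec2.
by apply: within_add; first apply: within_add; apply: within_mul => //; exact: fstc.
Qed.

End MixCoefficients.

(** * Deformation of a map from the cube into the complex *)

Section Deformation.
Variables (R : realType) (X : metricType R) (I : Type) (U : I -> set X).
Hypothesis bndU : uniformly_bounded U.
Hypothesis openU : open_cover U.
Local Notation Y := (set_type (vietoris_thickening U)).
Local Notation to_complex := (@to_complex R X I U).
Local Notation m := (@set_val _ (vietoris_thickening U)).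

(** The finite support of [y] lies in an open set [U i]. Put a bump supported in [U i] around each
    of its points; one minus the product of the complements is 1 on the support and vanishes outside
    [U i]. *)
Lemma thickening_cutoff (y : Y) : exists ip : I * (X -> R),
  [/\ unit_lipschitz ip.2, expect (m y) ip.2 = 1 &
      forall x, ip.2 x != 0 -> U ip.1 x].
Proof.
have [i yU] : vietoris_thickening U (m y) by apply/set_mem/valP.
have [r rP] : {r : X -> R & forall x, 0 < r x /\
    (U i x -> forall z, mdist x z < r x -> U i z)}.
  apply: (@choice _ _ (fun x r => 0 < r /\
    (U i x -> forall z, mdist x z < r -> U i z))) => x.
  have [Ux|Ux] := pselect (U i x); last by exists 1; split=> // /Ux.
  have /nbhs_ballP[r /= r0 rU] : nbhs x (U i).
    by apply: open_nbhs_nbhs; split=> //; case: openU => _; apply.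
  by exists r; split=> // _ z xz; apply: rU; rewrite ballEmdist.
pose S := finsupp (m y).
pose phi z := 1 - \prod_(x <- S) (1 - bump x (r x) z).
exists (i, phi); split=> /=.
- apply: unit_lipschitzC; apply: unit_lipschitz_prod => x.
  by apply: unit_lipschitzC; apply: unit_lipschitz_bump; case: (rP x).
- rewrite -(expect_cst (m y) 1); apply: eq_expect => x xS.
  by rewrite /phi (big_fsetD1 x) //= bumpxx subrr mul0r subr0.
- move=> z phiz; apply: contrapT => Uz; move/negP: phiz; apply.
  rewrite /phi big1_seq ?subrr // => x /= xS; apply/eqP.
  rewrite subr_eq addrC -subr_eq subrr eq_sym eq_le; have [r0 rU] := rP x.
  have [/(_ z)/andP[-> _] _] := unit_lipschitz_bump x r0; rewrite andbT leNgt.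
  by apply/negP => /(bump_gt0 r0) xz; apply/Uz/rU => //; exact: yU.
Qed.

(* [H] moves linearly from [f t] to its normalized restriction [nu t] by the
   cut-offs [psi t], and then linearly to the interpolation [gam t] between the
   points [xs j] chosen at the grid points. *)
Theorem thickening_deformation (n : nat) (f : 'rV[R]_n -> Y) (B : set 'rV[R]_n) :
  {within @cube R n, continuous f} -> B `<=` @cube R n -> closed B ->
  {within B, continuous (to_complex \o f)} ->
  exists H : R * 'rV[R]_n -> Y,
    [/\ {within `[0, 1] `*` @cube R n, continuous H},
        forall t, cube t -> H (0, t) = f t,
        {within `[0, 1] `*` B, continuous (to_complex \o H)} &
        {within @cube R n, continuous (fun t => to_complex (H (1, t)))}].
Proof.
move=> fc BC clB fB; pose C := @cube R n.
have [ip ipP] := choice (fun t => thickening_cutoff (f t)).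
pose phi t := (ip t).2.
have phiL t : unit_lipschitz (phi t) by have [] := ipP t.
have phi01 t x : 0 <= phi t x <= 1 by have [/(_ x)] := phiL t.
have phi1 t : expect (m (f t)) (phi t) = 1 by have [] := ipP t.
have phiU t x : phi t x != 0 -> U (ip t).1 x by have [_ _] := ipP t; apply.
pose N : nat := 7 ^ n; pose e : R := N.+1%:R^-1.
have e0 : 0 < e by rewrite invr_gt0 ltr0n.
(* The implication makes [W c] a neighbourhood of [c] in the whole space of rows, not just within
   the cube. *)
pose W c := [set t | C t -> 1 - e < expect (m (f t)) (phi c)].
have nW c : C c -> nbhs c (W c).
  move=> Cc; have /subspace_continuousP/(_ c Cc) := thickening_expect (phiL c) fc.
  by move=> /cvgr_gt; apply; rewrite [ltRHS]phi1; lra.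
have [J [c [p [lam [hat [[Ccp lhc] lh01 card_act lamW core]]]]]] := grid_partition nW.
have lam01 j t : 0 <= lam j t <= 1 by case: (lh01 j t).
have hat0 j t : 0 <= hat j t by case: (lh01 j t).
(* Interpolates between no cut-off where [lam j] is 0 and the full cut-off [phi (c j)] where it is
   1. *)
pose fac j t x := 1 - lam j t * (1 - phi (c j) x).
have fac01 j t x : 0 <= lam j t * (1 - phi (c j) x) <= 1.
  have /andP[? ?] := lam01 j t; have /andP[? ?] := phi01 (c j) x.
  by apply/andP; split; nra.
pose psi t x := \prod_j fac j t x.
have psi0 t x : 0 <= psi t x.
  by apply: prodr_ge0 => j _; rewrite subr_ge0; case/andP: (fac01 j t x).
have psi_core j t x : lam j t = 1 -> psi t x != 0 -> phi (c j) x != 0.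
  move=> l1; apply: contraNneq => phix.
  by rewrite /psi (bigD1 j) //= /fac l1 phix subr0 mulr1 subrr mul0r.
pose Z t := expect (m (f t)) (psi t).
have Z0 t : C t -> 0 < Z t.
  move=> Ct; pose q j t := lam j t * (1 - expect (m (f t)) (phi (c j))).
  have Zq : 1 - \sum_j q j t <= Z t.
    apply: (@le_trans _ _ (expect (m (f t))
        (fun x => 1 - \sum_j lam j t * (1 - phi (c j) x)))); last first.
      by apply: expect_le => x _; exact: prod_1B_ge.
    rewrite expectD expect_cst lerD2l.
    under [leRHS]eq_expect do rewrite -mulN1r.
    rewrite expectZ mulN1r lerN2 expect_sum; apply: ler_sum => j _.
    rewrite expectZ expectD expect_cst.
    under eq_expect do rewrite -mulN1r.
    by rewrite expectZ mulN1r.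
  apply: lt_le_trans Zq; rewrite subr_gt0.
  (* Only indices in [A] cost mass, each at most [e]; there are at most [N] of them, and [N * e < 1]
     since [e] is the inverse of [N + 1]. *)
  pose A := [set j | lam j t != 0]%SET.
  apply: (@le_lt_trans _ _ (\sum_(j in A) e)).
    rewrite [leRHS]big_mkcond; apply: ler_sum => j _; rewrite inE.
    have [lt0|lt0] := eqVneq; first by rewrite /q lt0 mul0r.
    have lE : 1 - e < expect (m (f t)) (phi (c j)) := lamW j t lt0 Ct.
    have /andP[l0 l1] := lam01 j t.
    have ej1 : expect (m (f t)) (phi (c j)) <= 1.
      rewrite -(expect_cst (m (f t)) 1); apply: expect_le => x _.
      by case/andP: (phi01 (c j) x).
    rewrite /q; apply: (@le_trans _ _ (1 - expect (m (f t)) (phi (c j)))); last by lra.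
    by rewrite ler_piMl // subr_ge0.
  rewrite sumr_const -mulr_natl ltr_pdivrMr ?ltr0n // mul1r ltr_nat ltnS.
  exact: card_act.
(* The weight [psi t] varies with [t]. Expanding one factor at a time moves the dependence on [t]
   into continuous coefficients and replaces the test function [g] by [g] or [g * phi (c j)]. *)
have psi_cont g : unit_lipschitz g ->
    {within C, continuous (fun t => expect (m (f t)) (fun x => g x * psi t x))}.
  rewrite /psi; elim: (index_enum J) g => [|j r IH] g gL.
    apply: (within_eq (f := fun t => expect (m (f t)) g)).
      by move=> t _; apply: eq_expect => x _; rewrite big_nil mulr1.
    exact: thickening_expect.
  apply: (within_eq (f := fun t =>
      (1 - lam j t) * expect (m (f t)) (fun x => g x * \prod_(i <- r) fac i t x)
      + lam j t * expect (m (f t)) (fun x => (g x * phi (c j) x) *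
          \prod_(i <- r) fac i t x))).
    move=> t _; rewrite -!expectZ -expectD; apply: eq_expect => x _.
    by rewrite big_cons /fac; ring.
  have lc : {within C, continuous (lam j)}.
    by apply: continuous_subspaceT; case: (lhc j).
  apply: within_add; apply: within_mul => //.
  - apply: continuous_subspaceT; apply: continuous_flip; by case: (lhc j).
  - exact: IH.
  - by apply: IH; exact: unit_lipschitzM.
have Zc : {within C, continuous Z}.
  apply: (within_eq (f := fun t => expect (m (f t)) (fun x => 1 * psi t x))); last first.
    by apply: psi_cont; exact: unit_lipschitz1.
  move=> t _; rewrite /Z.
  by apply: eq_expect => x _; rewrite mul1r.
have psitc E x : {within E, continuous (fun t => psi t x)}.
  apply: within_prod => j; apply: continuous_subspaceT; apply: continuous_flip.
  rewrite (_ : (fun t => _) = fun t => (1 - phi (c j) x) * lam j t).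
    by apply: continuous_scale; case: (lhc j).
  by apply/funext => t; rewrite mulrC.
have [nu nuE] : {nu : 'rV[R]_n -> finprob R X & forall t, C t ->
    forall v, nu t v = psi t v * m (f t) v / Z t}.
  apply: (@choice 'rV[R]_n (finprob R X) (fun t nu => C t -> forall v, nu v = psi t v * m (f t) v / Z t)).
  move=> t; have [Ct|Ct] := pselect (C t); last by exists (m (f t)) => /Ct.
  by have [nu nuE] := finprob_reweight (psi0 t) (Z0 t Ct); exists nu.
(* A point surviving the cut-offs at [p j] lies in the cover set chosen for [c i] whenever
   [lam i (p j) = 1]. *)
have [xs xsP] : {xs : J -> X & forall j, psi (p j) (xs j) != 0}.
  apply: (@choice J X (fun j x => psi (p j) x != 0)) => j.
  apply: contrapT => psi00; have := Z0 (p j) (Ccp j).2.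
  rewrite /Z (@eq_expect _ _ _ _ (fun=> 0)) ?expect_cst ?ltxx // => x _.
  by apply/eqP; apply: contrapT => /negP ?; apply: psi00; exists x.
pose G t := \sum_j hat j t.
have G0 t : C t -> 0 < G t.
  move=> /core[j [_ hj _]]; rewrite /G (bigD1 j) //=.
  by apply: ltr_pwDl => //; apply: sumr_ge0.
have hatc j : {within C, continuous (hat j)}.
  by apply: continuous_subspaceT; case: (lhc j).
have qc j : {within C, continuous (fun t => hat j t / G t)}.
  apply: within_div => //; first by move=> t /G0; rewrite lt0r => /andP[].
  by apply: within_sum.
have [gam gamE] : {gam : 'rV[R]_n -> finprob R X & forall t, C t ->
    forall v, gam t v = \sum_j (xs j == v)%:R * (hat j t / G t)}.
  apply: (@choice 'rV[R]_n (finprob R X) (fun t gam => C t ->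
    forall v, gam v = \sum_j (xs j == v)%:R * (hat j t / G t))) => t.
  have [Ct|Ct] := pselect (C t); last by exists (m (f t)) => /Ct.
  have q0 j : 0 <= hat j t / G t by rewrite divr_ge0 // ltW // G0.
  have q1 : \sum_j hat j t / G t = 1 by rewrite -mulr_suml divff // gt_eqF // G0.
  by have [gam gamE] := finprob_points xs q0 q1; exists gam.
have suppf t v : C t -> nu t v != 0 -> m (f t) v != 0.
  by move=> Ct; rewrite nuE //; apply: contraNneq => ->; rewrite mulr0 mul0r.
(* The set belongs to the index [j] that [core] provides: [lam j t = 1] places the support of [nu t]
   in it, and [lam j (p i) = 1] places there each [xs i] whose hat is positive at [t]. *)
have common t : C t -> exists k,
    (forall x, nu t x != 0 -> U k x) /\ (forall x, gam t x != 0 -> U k x).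
  move=> Ct; have [j [lj hj pj]] := core t Ct; exists (ip (c j)).1; split=> x.
    rewrite nuE // => nux; apply: phiU; apply: (psi_core j t) => //.
    by apply: contraNneq nux => ->; rewrite !mul0r.
  rewrite gamE // => gx.
  have [i xi hi] : exists2 i, xs i = x & hat i t != 0.
    apply: contrapT => nox; move/negP: gx; apply; apply/eqP; apply: big1 => i _.
    have [xi|_] := eqVneq (xs i) x; last by rewrite mul0r.
    have [->|hi] := eqVneq (hat i t) 0; first by rewrite mul0r mulr0.
    by exfalso; apply: nox; exists i.
  rewrite -xi; apply: phiU; apply: (psi_core j (p i)) => //; apply: pj.
  by rewrite lt0r hi hat0.
have [H HE] : {H : R * 'rV[R]_n -> Y & forall z, (0 <= z.1 <= 1 /\ C z.2) -> forall v,
    m (H z) v = mix0 z.1 * m (f z.2) v + mix1 z.1 * nu z.2 v + mix2 z.1 * gam z.2 v}.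
  apply: (@choice (R * 'rV[R]_n) Y (fun z y => (0 <= z.1 <= 1 /\ C z.2) -> forall v, m y v =
    mix0 z.1 * m (f z.2) v + mix1 z.1 * nu z.2 v + mix2 z.1 * gam z.2 v)) => -[s t] /=.
  have [[s01 Ct]|st] := pselect (0 <= s <= 1 /\ C t); last by exists (f t) => /st.
  have [a0 b0 c0] := mix_ge0 s01.
  have [mu muE] := finprob_mix (m (f t)) (nu t) (gam t) a0 b0 c0 (mix_sum s).
  suff muU : mu \in vietoris_thickening U by exists (SigSub muU).
  apply/mem_set; have [sc|sc] := mix_cases s.
    have [k fU] : vietoris_thickening U (m (f t)) by apply/set_mem/valP.
    exists k => v /=; rewrite finsuppE muE sc mul0r addr0 => mv; apply: fU => /=.
    rewrite finsuppE; apply: contraNneq mv => fv.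
    by rewrite fv nuE // fv !mulr0 mul0r mulr0 addr0.
  have [k [nuU gamU]] := common t Ct; exists k => v /=.
  rewrite finsuppE muE sc mul0r add0r => mv.
  have [nv|/nuU //] := eqVneq (nu t v) 0; apply: gamU.
  by apply: contraNneq mv => ->; rewrite nv !mulr0 addr0.
have domE (z : R * 'rV[R]_n) E : E `<=` C -> (`[0, 1] `*` E) z -> 0 <= z.1 <= 1 /\ C z.2.
  by move=> EC [/=]; rewrite in_itv /= => ? /EC.
have [D D0 diamU] := uniform_bound bndU.
have HC : {within `[0, 1] `*` C, continuous H}.
  apply: (thickening_continuous bndU (p := snd) (g := f) (E := C) (D := D)) => //.
  - by move=> z [].
  - exact: continuous_snd.
  - move=> z v /(domE _ _ (@subset_refl _ C)) zC; rewrite finsuppE HE // => Hv.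
    have Ct : C z.2 by case: zC.
    (* In the first stage [v] is itself charged by [f z.2]; in the second it shares a set of the
       cover with a point charged by [nu z.2], hence by [f z.2]. *)
    have [sc|sc] := mix_cases z.1.
      exists v; last by rewrite mdistxx.
      rewrite finsuppE; apply: contraNneq Hv => fv.
      by rewrite sc nuE // fv !mulr0 mul0r mulr0 mul0r !addr0.
    have [k [nuU gamU]] := common _ Ct.
    have [x xnu] := finsupp_neq0 (nu z.2); rewrite finsuppE in xnu.
    exists x; first by rewrite finsuppE suppf.
    apply: (diamU k); first exact: nuU.
    have [nv|/nuU //] := eqVneq (nu z.2 v) 0; apply: gamU.
    by apply: contraNneq Hv => ->; rewrite sc nv mul0r !mulr0 !addr0.
  - move=> h hL; apply: (within_eq (f := fun z => mix0 z.1 * expect (m (f z.2)) h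
      + mix1 z.1 * (expect (m (f z.2)) (fun x => h x * psi z.2 x) / Z z.2)
      + mix2 z.1 * (\sum_j h (xs j) * (hat j z.2 / G z.2)))).
      move=> z /(domE _ _ (@subset_refl _ C)) zC; rewrite (expect_mix _ (HE z zC)).
      case: zC => _ Ct; congr (_ * _ + _ * _ + _ * _).
        by rewrite (expect_reweight _ (nuE _ Ct)) // Z0.
      by rewrite (expect_points _ (gamE _ Ct)).
    apply: (mix_within (e0 := fun t => expect (m (f t)) h)
      (e1 := fun t => expect (m (f t)) (fun x => h x * psi t x) / Z t)
      (e2 := fun t => \sum_j h (xs j) * (hat j t / G t))).
    + exact: thickening_expect.
    + apply: within_div => //; first by move=> t /Z0; rewrite lt0r => /andP[].
      exact: psi_cont.
    + by apply: within_sum => j; apply: within_mul; first exact: within_cst.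
have gamc v : {within C, continuous (fun t => gam t v)}.
  apply: (within_eq (f := fun t => \sum_j (xs j == v)%:R * (hat j t / G t))).
    by move=> t Ct; rewrite gamE.
  by apply: within_sum => j; apply: within_mul; first exact: within_cst.
pose Axs := [fset xs j | j in J]%fset.
have gamA t : C t -> (finsupp (gam t) `<=` Axs)%fset.
  move=> Ct; apply/fsubsetP => v; rewrite finsuppE gamE //; apply: contraR => vx.
  rewrite big1 // => j _; rewrite (_ : (xs j == v) = false) ?mul0r //.
  by apply: contraNF vx => /eqP <-; apply/imfsetP; exists j.
exists H; split=> //.
- move=> t Ct; apply/val_inj/finprobP => v.
  have [a0 b0 c0] := @mix_at0 R.
  rewrite [LHS](HE (0, t)) /= ?a0 ?b0 ?c0 ?mul1r ?mul0r ?addr0 //.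
  by split=> //; rewrite lexx ler01.
- have cB : compact B by apply: subclosed_compact (@compact_cube R n) BC.
  (* Over [B] the homotopy stays in the span of the finite set [A] and the points [xs j], where
     continuity can be checked coordinatewise. *)
  have [A AP] := to_complex_finite_support cB fB.
  apply: (to_complex_continuous (A := (A `|` Axs)%fset)) => [z zB|v].
    have zC := domE z B BC zB; apply/fsubsetP => v; rewrite finsuppE HE // => Hv.
    have Bz : B z.2 by case: zB.
    have Cz : C z.2 by case: zC.
    rewrite inE; apply/orP; have [fv|fv] := eqVneq (m (f z.2) v) 0; last first.
      by left; apply: (fsubsetP (AP _ Bz)); rewrite finsuppE.
    right; apply: (fsubsetP (gamA _ Cz)); rewrite finsuppE.
    apply: contraNneq Hv => gv; rewrite fv gv nuE // fv.
    by rewrite !mulr0 mul0r mulr0 !addr0.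
  apply: (within_eq (f := fun z => mix0 z.1 * m (f z.2) v + mix1 z.1 * nu z.2 v
    + mix2 z.1 * gam z.2 v)) => [z /(domE _ _ BC) zC|]; first by rewrite HE.
  apply: (mix_within (e0 := fun t => m (f t) v) (e1 := fun t => nu t v)
    (e2 := fun t => gam t v)).
  + exact: to_complex_coord.
  + apply: (within_eq (f := fun t => psi t v * m (f t) v / Z t)).
      by move=> t /BC Ct; rewrite nuE.
    apply: within_div.
    * by move=> t /BC /Z0; rewrite lt0r => /andP[].
    * apply: within_mul; last exact: to_complex_coord.
      exact: psitc.
    * exact: within_sub Zc.
  + exact: within_sub (gamc v).
- have one t : C t -> forall v, m (H (1, t)) v = gam t v.
    move=> Ct v; have [a0 b0 c0] := @mix_at1 R.
    rewrite [LHS](HE (1, t)) /= ?a0 ?b0 ?c0 ?mul1r ?mul0r ?add0r //.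
    by split=> //; rewrite ler01 lexx.
  apply: (to_complex_continuous (f := fun t => H (1, t)) (A := Axs)) => [t Ct|v].
    apply/fsubsetP => v; rewrite finsuppE one // -finsuppE.
    exact: (fsubsetP (gamA t Ct)).
  by apply: (within_eq (f := fun t => gam t v)) => // t Ct; rewrite one.
Qed.

End Deformation.

(** * Compression relative to the boundary of the cube *)

Section Compression.
Variables (R : realType) (n : nat).
Implicit Types (t : 'rV[R]_n) (s : R).

Definition cube_center : 'rV[R]_n := const_mx (1 / 2).
(** Rows carry the maximum norm, so the cube is the closed ball of radius 1/2 around its centre, and
    its boundary is the sphere. *)
Definition center_dist t : R := `|t - cube_center|.

Lemma cubeP t : cube t <-> center_dist t <= 1 / 2.
Proof.
split=> tc => [|j].
  rewrite leNgt; apply/negP => tc'; have t0 : 0 < center_dist t by lra.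
  have [[i j] e] := mx_norm_neq0 (lt0r_neq0 t0).
  move: tc'; rewrite /center_dist [X in _ < X]e /= !mxE ord1.
  have /andP[t1 t2] := tc j; apply/negP; rewrite -leNgt ler_norml.
  by apply/andP; split; lra.
have := le_trans (row_norm_coord (t - cube_center) j) tc.
by rewrite !mxE ler_norml => /andP[? ?]; apply/andP; split; lra.
Qed.

Lemma cube_boundaryP t : cube_boundary t <-> center_dist t = 1 / 2.
Proof.
split=> [[tc [j tj]]|tc].
  apply/eqP; rewrite eq_le; apply/andP; split; first exact/cubeP.
  apply: le_trans (row_norm_coord (t - cube_center) j).
  by rewrite !mxE; case: tj => ->; rewrite ?sub0r ?normrN ger0_norm //; lra.
split; first by apply/cubeP; rewrite tc.
have t0 : center_dist t != 0 by rewrite tc; lra.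
have [[i j] e] := mx_norm_neq0 t0.
have H : `|t ord0 j - 1 / 2| = 1 / 2.
  by move: e; rewrite /= !mxE ord1 => <-.
exists j; have [tj|tj] := leP (1 / 2) (t ord0 j); [right|left].
  by move: H; rewrite ger0_norm; lra.
by move: H; rewrite ltr0_norm; lra.
Qed.

(* The radial expansion by the factor 2 of the inner cube, extended by the radial
   projection of the collar onto the boundary. *)
Definition expand_factor t : R := (Num.max (1 / 2) (2 * center_dist t))^-1.
(** Equal to 1 on the inner cube of radius 1/4, decreasing linearly to 0 across the collar. *)
Definition collar_time t : R := Num.min 1 (2 - 4 * center_dist t).
Definition expand s t : 'rV[R]_n :=
  cube_center + ((1 - s) + s * expand_factor t) *: (t - cube_center).

Lemma center_dist_continuous : continuous center_dist.
Proof.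
have affc : continuous (fun t : 'rV[R]_n => t - cube_center).
  apply: continuous_row => i.
  rewrite (_ : (fun t => _) = fun t : 'rV[R]_n => 1 * t ord0 i + - (1 / 2)).
    by apply: continuous_affine; exact: coord_continuous.
  by apply/funext => t; rewrite !mxE [1 * t _ _]mul1r.
exact: (continuous_compT affc (@norm_continuous _ 'rV[R]_n)).
Qed.

Lemma expand_max_gt0 t : 0 < Num.max (1 / 2) (2 * center_dist t).
Proof. by rewrite lt_max; apply/orP; left; lra. Qed.

Lemma expand_factor_continuous : continuous expand_factor.
Proof.
have mc : continuous (fun d : R => (Num.max (1 / 2) (2 * d))^-1).
  move=> d; apply: cvgV; first by rewrite lt0r_neq0 // lt_max; apply/orP; left; lra.
  apply: cvg_maxr; first exact: cvg_cst.
  by apply: continuous_scale => x; exact: cvg_id.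
exact: (continuous_compT center_dist_continuous mc).
Qed.

Lemma collar_time_continuous : continuous collar_time.
Proof.
have mc : continuous (fun d : R => Num.min 1 (2 - 4 * d)).
  move=> d; apply: cvg_minr; first exact: cvg_cst.
  apply: cvgB; first exact: cvg_cst.
  by apply: continuous_scale => x; exact: cvg_id.
exact: (continuous_compT center_dist_continuous mc).
Qed.

Lemma expand_continuous : continuous (fun z : R * 'rV[R]_n => expand z.1 z.2).
Proof.
apply: continuous_row => i.
rewrite (_ : (fun z => _) = fun z : R * 'rV[R]_n =>
  1 / 2 + ((1 - z.1) + z.1 * expand_factor z.2) * (1 * z.2 ord0 i + - (1 / 2))); last first.
  by apply/funext => z; rewrite !mxE [1 * z.2 _ _]mul1r.
have sndc := @continuous_snd R 'rV[R]_n; have fstc := @continuous_fst R 'rV[R]_n.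
have kc := continuous_compT sndc expand_factor_continuous.
have tc := continuous_compT sndc (@coord_continuous R 1 n ord0 i).
have ac := @continuous_affine R _ _ 1 (- (1 / 2)) tc.
have bc := continuous_flip fstc.
move=> z; apply: cvgD; first exact: cvg_cst.
apply: cvgM; last exact: ac.
by apply: cvgD; [exact: bc|apply: cvgM; [exact: fstc|exact: kc]].
Qed.

Lemma expand_dist s t : 0 <= s <= 1 ->
  center_dist (expand s t) = ((1 - s) + s * expand_factor t) * center_dist t.
Proof.
move=> /andP[s0 s1]; rewrite /center_dist /expand addrC addKr normrZ ger0_norm //.
by rewrite addr_ge0 ?mulr_ge0 ?invr_ge0 ?subr_ge0 // ltW // expand_max_gt0.
Qed.

Lemma expand_factor_outer t : 1 / 4 <= center_dist t ->
  expand_factor t * center_dist t = 1 / 2.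
Proof.
move=> t4; rewrite /expand_factor max_r; last by lra.
by field; lra.
Qed.

Lemma expand_factor_inner t : center_dist t <= 1 / 4 -> expand_factor t = 2.
Proof.
by move=> t4; rewrite /expand_factor max_l; [rewrite div1r invrK|lra].
Qed.

Lemma cube_expand s t : 0 <= s <= 1 -> cube t -> cube (expand s t).
Proof.
move=> s01 /cubeP tc; apply/cubeP; rewrite expand_dist // mulrDl -mulrA.
have kt : expand_factor t * center_dist t <= 1 / 2.
  have [t4|t4] := leP (1 / 4) (center_dist t); first by rewrite expand_factor_outer.
  by rewrite expand_factor_inner ?(ltW t4) //; lra.
by case/andP: s01 => s0 s1; nra.
Qed.

Lemma boundary_expand t : 1 / 4 <= center_dist t -> cube_boundary (expand 1 t).
Proof.
move=> t4; apply/cube_boundaryP; rewrite expand_dist ?lexx ?ler01 //.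
by rewrite subrr add0r mul1r expand_factor_outer.
Qed.

Lemma expand0 t : expand 0 t = t.
Proof. by rewrite /expand subr0 mul0r addr0 scale1r addrC subrK. Qed.

Lemma expand_boundary s t : cube_boundary t -> expand s t = t.
Proof.
move=> /cube_boundaryP td; rewrite /expand /expand_factor td max_r; last by lra.
have -> : (2 * (1 / 2))^-1 = 1 :> R by rewrite mul1r divff ?invr1.
by rewrite mulr1 subrK scale1r addrC subrK.
Qed.

Lemma collar_time01 t : cube t -> 0 <= collar_time t <= 1.
Proof.
move=> /cubeP tc; rewrite /collar_time le_min ge_min lexx ler01 /= andbT; lra.
Qed.

Lemma collar_time_inner t : center_dist t <= 1 / 4 -> collar_time t = 1.
Proof. by move=> t4; rewrite /collar_time min_l //; lra. Qed.

Lemma collar_time_boundary t : cube_boundary t -> collar_time t = 0.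
Proof. by move=> /cube_boundaryP td; rewrite /collar_time td min_r; lra. Qed.

Lemma closed_cube_boundary : closed (@cube_boundary R n).
Proof.
rewrite (_ : cube_boundary (k := n) = center_dist @^-1` [set 1 / 2]).
  apply: preimage_closed; last exact: closed_eq.
  by move=> t _; exact: center_dist_continuous.
by apply/seteqP; split=> t /cube_boundaryP.
Qed.

Variables (X : metricType R) (I : Type) (U : I -> set X).
Hypothesis bndU : uniformly_bounded U.
Hypothesis openU : open_cover U.
Local Notation Y := (set_type (vietoris_thickening U)).
Local Notation to_complex := (@to_complex R X I U).

(* A homotopy that deforms [f] into the complex but moves the boundary is run for
   less and less time in the collar of the cube. *)
Theorem thickening_compression (f : 'rV[R]_n -> Y) :
  {within @cube R n, continuous f} ->
  {within @cube_boundary R n, continuous (to_complex \o f)} ->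
  exists G : R * 'rV[R]_n -> Y,
    [/\ {within `[0, 1] `*` @cube R n, continuous G},
        forall t, cube t -> G (0, t) = f t,
        forall s t, 0 <= s <= 1 -> cube_boundary t -> G (s, t) = f t &
        {within @cube R n, continuous (to_complex \o (fun t => G (1, t)))}].
Proof.
move=> fc fb; have [|H [Hc H0 Hb H1]] :=
  thickening_deformation bndU openU fc _ closed_cube_boundary fb; first by move=> t [].
have timec : continuous (fun z : R * 'rV[R]_n => z.1 * collar_time z.2).
  have sc := continuous_compT (@continuous_snd R 'rV[R]_n) collar_time_continuous.
  by move=> z; apply: cvgM; [exact: continuous_fst|exact: sc].
exists (fun z => H (z.1 * collar_time z.2, expand z.1 z.2)); split.
- pose g (z : R * 'rV[R]_n) := (z.1 * collar_time z.2, expand z.1 z.2).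
  apply: (within_comp_sub (g := g) _ _ Hc).
    move=> [s t] /= [s01 ct]; rewrite in_itv /= in s01 *.
    split; last exact: cube_expand.
    have /andP[c0 c1] := collar_time01 ct; case/andP: s01 => s0 s1.
    by rewrite in_itv /= mulr_ge0 //= mulr_ile1.
  by apply: continuous_pair => //; exact: expand_continuous.
- by move=> t ct; rewrite /= mul0r expand0 H0.
- move=> s t s01 bt; rewrite /= collar_time_boundary // mulr0 expand_boundary // H0 //.
  by case: bt.
- have ec : continuous (expand 1).
    have pc : continuous (fun t : 'rV[R]_n => (1 : R, t)).
      by apply: continuous_pair; [exact: cst_continuous|move=> t; exact: cvg_id].
    exact: (continuous_compT pc expand_continuous).
  (* The inner cube sees only the final stage of [H], which is continuous into the complex; the
     collar is sent into the boundary, over which [H] is continuous into the complex at all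
     times. *)
  pose inner t := to_complex (H (1, expand 1 t)).
  pose outer t := to_complex (H (collar_time t, expand 1 t)).
  apply: (within_eq (f := fun t => if center_dist t <= 1 / 4 then inner t else outer t)).
    move=> t ct /=; rewrite [1 * collar_time t]mul1r; case: ifPn => // t4.
    by rewrite collar_time_inner.
  have s1 : 0 <= (1 : R) <= 1 by rewrite lexx ler01.
  apply: within_if.
  + exact: closed_cube.
  + exact: center_dist_continuous.
  + apply: (within_comp_sub (g := expand 1) _ _ H1) => // t [ct _].
    exact: cube_expand.
  + pose g t := (collar_time t, expand 1 t).
    apply: (within_comp_sub (g := g) _ _ Hb).
      move=> t [ct /= t4]; split=> /=; last exact: boundary_expand.
      by rewrite in_itv /=; exact: collar_time01.
    by apply: continuous_pair => //; exact: collar_time_continuous.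
  + by move=> t ct t4; rewrite /inner /outer collar_time_inner // t4.
Qed.

End Compression.

(** * Homotopy groups *)

Section PathComponents.
Variables (R : realType) (Y : topologicalType).
Implicit Types x y z : Y.

Lemma cube_boundary0 (t : 'rV[R]_0) : ~ cube_boundary t.
Proof. by case=> _ [[]]. Qed.

Definition point_gloop (b : Y) y : gloop R 0 b.
Proof.
refine (@GLoop R 0 Y b (fun=> y) _ _).
  by apply: continuous_subspaceT; exact: cst_continuous.
by move=> t /cube_boundary0.
Defined.

(** The 0-cube is a point with empty boundary, so a homotopy of loops on it is a path and the base
    point [b] is arbitrary. *)
Lemma path_componentP (b : Y) y z :
  path_component R y z <-> gloop_homotopic (point_gloop b y) (point_gloop b z).
Proof.
split=> [[f [fc f0 f1]]|[H [Hc H0 H1 _]]].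
  exists (f \o fst); split=> [|t _|t _|s t _ /cube_boundary0 //].
  - apply: (within_comp_sub (g := fst) _ _ fc) => [z' [] //|].
    exact: continuous_fst.
  - exact: f0.
  - exact: f1.
have c0 : cube (0 : 'rV[R]_0) by case.
exists (fun s => H (s, 0)); split; [|exact: H0|exact: H1].
apply: (within_comp_sub (g := fun s : R => (s, 0 : 'rV[R]_0)) _ _ Hc) => [s s01|].
  by split.
by apply: continuous_pair => s; [exact: cvg_id|exact: cvg_cst].
Qed.

Lemma path_component_refl y : path_component R y y.
Proof. exact/(path_componentP y)/gloop_homotopic_refl. Qed.

Lemma path_component_eq x y : path_component R x y ->
  path_component R x = path_component R y.
Proof.
move=> /(path_componentP x) xy; apply/seteqP; split=> z /(path_componentP x) h;
  apply/(path_componentP x).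
  exact: gloop_homotopic_trans (gloop_homotopic_sym xy) h.
exact: gloop_homotopic_trans xy h.
Qed.

Lemma transversal_exists : exists S : set Y, transversal_of_path_components R S.
Proof.
pose T := set_type (@path_components R Y).
have [r rP] : {r : T -> Y & forall C, set_val C (r C)}.
  apply: (@choice T Y (fun C y => set_val C y)) => C.
  have /set_mem[y _ Cy] := valP C; exists y.
  by rewrite -[set_val C]Cy; exact: path_component_refl.
exists (range r) => C pC; exists (r (SigSub (mem_set pC))); split.
  by split; [exists (SigSub (mem_set pC))|exact: (rP (SigSub (mem_set pC)))].
move=> _ [[D _ <-] CrD]; congr r; apply/val_inj => /=.
have /set_mem[x _ Dx] := valP D; have DrD := rP D.
case: pC CrD => y _ <- yrD; rewrite [RHS](_ : _ = path_component R x) //.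
rewrite (path_component_eq yrD) (@path_component_eq x (r D)) //.
by rewrite Dx; exact: DrD.
Qed.

End PathComponents.

(** * The cube of dimension k + 1 as a cylinder over the k-cube *)

Section FirstCoordinate.
Variables (R : realType) (k : nat).

Definition row_cons (z : R * 'rV[R]_k) : 'rV[R]_k.+1 :=
  \row_j (if unlift ord0 j is Some i then z.2 ord0 i else z.1).
Definition row_tail (u : 'rV[R]_k.+1) : 'rV[R]_k := \row_i u ord0 (lift ord0 i).

Lemma row_cons_head z : row_cons z ord0 ord0 = z.1.
Proof. by rewrite mxE unlift_none. Qed.

Lemma row_consK z : row_tail (row_cons z) = z.2.
Proof. by apply/rowP => i; rewrite !mxE liftK. Qed.

Lemma row_cons_continuous : continuous row_cons.
Proof.
apply: continuous_row => j.
rewrite (_ : (fun z => _) = fun z : R * 'rV[R]_k =>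
  if unlift ord0 j is Some i then z.2 ord0 i else z.1).
  case: unlift => [i|]; last exact: continuous_fst.
  exact: (continuous_compT (@continuous_snd R _) (@coord_continuous R 1 k ord0 i)).
by apply/funext => z; rewrite mxE.
Qed.

Lemma row_tail_continuous : continuous row_tail.
Proof.
apply: continuous_row => i.
rewrite (_ : (fun u => _) = fun u : 'rV[R]_k.+1 => u ord0 (lift ord0 i)).
  exact: coord_continuous.
by apply/funext => u; rewrite mxE.
Qed.

Lemma cube_row_cons (z : R * 'rV[R]_k) : 0 <= z.1 <= 1 -> cube z.2 -> cube (row_cons z).
Proof. by move=> z1 z2 j; rewrite mxE; case: unlift. Qed.

Lemma cube_row_tail (u : 'rV[R]_k.+1) : cube u -> cube (row_tail u).
Proof. by move=> cu i; rewrite mxE. Qed.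

Lemma boundary_row_cons (z : R * 'rV[R]_k) : 0 <= z.1 <= 1 -> cube z.2 ->
  [\/ z.1 = 0, z.1 = 1 | cube_boundary z.2] -> cube_boundary (row_cons z).
Proof.
move=> z1 z2 zb; split; first exact: cube_row_cons.
case: zb => [e|e|[_ [j e]]]; [exists ord0|exists ord0|exists (lift ord0 j)].
- by left; rewrite row_cons_head.
- by right; rewrite row_cons_head.
- by rewrite mxE liftK.
Qed.

Lemma boundary_cases (u : 'rV[R]_k.+1) : cube_boundary u ->
  [\/ u ord0 ord0 = 0, u ord0 ord0 = 1 | cube_boundary (row_tail u)].
Proof.
move=> [cu [j uj]]; case: (unliftP ord0 j) uj => [i ->|->] uj; last first.
  by case: uj; [constructor 1|constructor 2].
by constructor 3; split; [exact: cube_row_tail|exists i; rewrite mxE].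
Qed.

End FirstCoordinate.

(** * Homotopy groups of the thickening and of the complex *)

Section HomotopyGroups.
Variables (R : realType) (X : metricType R) (I : Type) (U : I -> set X).
Hypothesis bndU : uniformly_bounded U.
Hypothesis openU : open_cover U.
Local Notation Y := (set_type (vietoris_thickening U)).
Local Notation Y' := (realization R (vietoris_complex U)).
Local Notation to_complex := (@to_complex R X I U).
Local Notation to_thickening := (@to_thickening R X I U).

Lemma to_thickening_comp_continuous (T : topologicalType) (D : set T) (a : T -> Y') :
  compact D -> {within D, continuous a} -> {within D, continuous (to_thickening \o a)}.
Proof.
move=> cD ac; apply: to_thickening_continuous => //.
by apply: within_eq ac => t _ /=; rewrite to_thickeningK.
Qed.

Section Push.
Variables (k : nat) (y : Y).
Implicit Types (a b : gloop R k (to_complex y)) (f : gloop R k y).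

Lemma push_boundary a t : cube_boundary t -> to_thickening (a t) = y.
Proof. by move=> bt; rewrite gloop_bd // to_complexK. Qed.

Definition push a : gloop R k y :=
  GLoop (to_thickening_comp_continuous (@compact_cube R k) (@gloop_cont _ _ _ _ a))
    (@push_boundary a).

Lemma push_homotopic a b : gloop_homotopic a b -> gloop_homotopic (push a) (push b).
Proof.
move=> [H [Hc H0 H1 Hb]]; exists (to_thickening \o H); split=> [|t ct|t ct|s t s01 bt] /=.
- apply: to_thickening_comp_continuous => //.
  by apply: compact_setX; [exact: segment_compact|exact: compact_cube].
- by rewrite H0.
- by rewrite H1.
- by rewrite Hb // to_complexK.
Qed.

(** A loop is constant on the boundary, hence continuous into the complex there; its compression
    relative to the boundary ends in a loop of the complex. *)
Lemma push_surjective f : exists a, gloop_homotopic f (push a).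
Proof.
have fb : {within @cube_boundary R k, continuous (to_complex \o f)}.
  apply: (within_eq (f := fun=> to_complex y)) => [t bt|].
    by rewrite /= gloop_bd.
  by apply: continuous_subspaceT; exact: cst_continuous.
have [G [Gc G0 Gb G1]] := thickening_compression bndU openU (@gloop_cont _ _ _ _ f) fb.
have bd t : cube_boundary t -> (to_complex \o (fun t => G (1, t))) t = to_complex y.
  by move=> bt; rewrite /= Gb ?gloop_bd // lexx ler01.
exists (GLoop G1 bd); exists G; split=> // [t ct|s t].
  by rewrite /= to_complexK.
by rewrite /= in_itv /= => s01 bt; rewrite Gb // gloop_bd.
Qed.

(** A homotopy is a map of the cube of one dimension more. On the boundary of that cube it is [a],
    [b] or constant, thus already continuous into the complex, and compression relative to the
    boundary keeps these values. *)
Lemma push_injective a b : gloop_homotopic (push a) (push b) -> gloop_homotopic a b.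
Proof.
move=> [H [Hc H0 H1 Hb]].
pose F (u : 'rV[R]_k.+1) := H (u ord0 ord0, row_tail u).
have headc := @coord_continuous R 1 k.+1 ord0 ord0.
have tailc := @row_tail_continuous R k.
have Fc : {within @cube R k.+1, continuous F}.
  apply: (within_comp_sub (g := fun u : 'rV[R]_k.+1 => (u ord0 ord0, row_tail u)) _ _ Hc).
    move=> u cu; split=> /=; last exact: cube_row_tail.
    by rewrite in_itv /=; exact: cu.
  exact: continuous_pair.
pose B0 := @cube R k.+1 `&` [set u | u ord0 ord0 = 0].
pose B1 := @cube R k.+1 `&` [set u | u ord0 ord0 = 1].
pose B2 := @cube R k.+1 `&` [set u | cube_boundary (row_tail u)].
have closed_head (r : R) : closed (@cube R k.+1 `&` [set u | u ord0 ord0 = r]).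
  apply: closedI; first exact: closed_cube.
  apply: (preimage_closed (f := fun u : 'rV[R]_k.+1 => u ord0 ord0) (D := [set r])).
    by move=> u _; exact: headc.
  exact: closed_eq.
have closed2 : closed B2.
  apply: closedI; first exact: closed_cube.
  apply: (preimage_closed (f := @row_tail R k)); last exact: closed_cube_boundary.
  by move=> u _; exact: tailc.
(* Pasting over three closed pieces: the two ends [B0], [B1] and the side [B2]. *)
have Fb : {within @cube_boundary R k.+1, continuous (to_complex \o F)}.
  apply: (within_sub (E := B0 `|` B1 `|` B2)).
    move=> u bu; have cu : cube u by case: bu.
    by case: (boundary_cases bu) => ?; [left; left|left; right|right].
  have tail_cont (B : set 'rV[R]_k.+1) (c : gloop R k (to_complex y)) :
      B `<=` @cube R k.+1 -> {within B, continuous (c \o @row_tail R k)}.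
    move=> BC; apply: (within_comp_sub (g := @row_tail R k) _ _ (@gloop_cont _ _ _ _ c)).
      by move=> u /BC; exact: cube_row_tail.
    exact: tailc.
  apply: withinU_continuous => //; first by apply: closedU; exact: closed_head.
    apply: withinU_continuous; [exact: closed_head|exact: closed_head| |].
      apply: (within_eq (f := a \o @row_tail R k)); last by apply: tail_cont => u [].
      move=> u [cu u0]; rewrite /F /= u0 H0 /= ?to_thickeningK //.
      exact: cube_row_tail.
    apply: (within_eq (f := b \o @row_tail R k)); last by apply: tail_cont => u [].
    move=> u [cu u1]; rewrite /F /= u1 H1 /= ?to_thickeningK //.
    exact: cube_row_tail.
  apply: (within_eq (f := fun=> to_complex y)); last first.
    by apply: continuous_subspaceT; exact: cst_continuous.
  move=> u [cu bu]; rewrite /F /= Hb //= in_itv /=; exact: cu.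
have [G [Gc G0 Gb G1]] := thickening_compression bndU openU Fc Fb.
have one01 : 0 <= (1 : R) <= 1 by rewrite lexx ler01.
have end01 (s : R) : s = 0 \/ s = 1 -> 0 <= s <= 1.
  by case=> ->; rewrite lexx ler01.
have GF (s : R) t : 0 <= s <= 1 -> cube t -> [\/ s = 0, s = 1 | cube_boundary t] ->
    G (1, row_cons (s, t)) = H (s, t).
  move=> s01 ct st; rewrite Gb //; last exact: boundary_row_cons.
  by rewrite /F row_cons_head row_consK.
exists (fun z => to_complex (G (1, row_cons z))); split=> [|t ct|t ct|s t].
- apply: (within_comp_sub (g := @row_cons R k) _ _ G1).
    by move=> [s t] [/= s01 ct]; apply: cube_row_cons; rewrite //= -in_itv.
  exact: row_cons_continuous.
- rewrite (GF 0 t (end01 _ (or_introl erefl)) ct (Or31 _ _ erefl)) H0 //.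
  exact: to_thickeningK.
- rewrite (GF 1 t (end01 _ (or_intror erefl)) ct (Or32 _ _ erefl)) H1 //.
  exact: to_thickeningK.
- move=> s01 bt; have ct : cube t by case: bt.
  by rewrite GF ?Hb //; constructor 3.
Qed.

(** The inverse of the map that [push] induces on classes, taken in this direction because
    [to_complex] is the map that matches the base points. *)
Lemma pull_exists : exists psi : homotopy_group R k y -> homotopy_group R k (to_complex y),
  bijective psi /\ forall a, psi (gloop_class (push a)) = gloop_class a.
Proof.
have [psi psiP] : {psi : homotopy_group R k y -> homotopy_group R k (to_complex y) &
    forall A, exists2 a, psi A = gloop_class a & A = gloop_class (push a)}.
  apply: (@choice (homotopy_group R k y) (homotopy_group R k (to_complex y))
    (fun A B => exists2 a, B = gloop_class a & A = gloop_class (push a))).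
  elim/gloop_class_ind => f; have [a fa] := push_surjective f.
  by exists (gloop_class a), a => //; exact/gloop_classP.
have psi_push a : psi (gloop_class (push a)) = gloop_class a.
  have [b -> /gloop_classP ab] := psiP (gloop_class (push a)).
  exact/gloop_classP/gloop_homotopic_sym/push_injective.
exists psi; split=> //.
exists (fun B => gloop_class (push (repr B))) => [A|B].
  have [a -> ->] := psiP A; apply/gloop_classP/push_homotopic/gloop_classP.
  exact: reprK.
by rewrite psi_push; exact: reprK.
Qed.

End Push.

Lemma gloop_eq_homotopic k (T : topologicalType) (t0 : T) (f g : gloop R k t0) :
  f =1 g -> gloop_homotopic f g.
Proof.
move=> fg; have [H [Hc H0 H1 Hb]] := gloop_homotopic_refl f.
by exists H; split=> // t ct; rewrite H1.
Qed.

(** [push] preserves constant loops and concatenation pointwise, so its inverse on classes respects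
    base points and products. *)
Lemma to_complex_homotopy_group_iso k (y : Y) :
  homotopy_group_iso R k y (to_complex y).
Proof.
have base n : gloop_homotopic (gloop_cst R n y) (push (gloop_cst R n (to_complex y))).
  by apply: gloop_eq_homotopic => t /=; rewrite to_complexK.
case: k => [|k].
  have [psi [psibij psi_push]] := pull_exists 0 y; exists psi => //.
  by rewrite /homotopy_group_base ((gloop_classP _ _).2 (base 0%N)) psi_push.
have [psi [psibij psi_push]] := pull_exists k.+1 y; exists psi => // A B.
move: A B; apply: gloop_class_ind => f; apply: gloop_class_ind => g'.
have [a fa] := push_surjective f; have [b gb] := push_surjective g'.
rewrite ((gloop_classP _ _).2 fa) ((gloop_classP _ _).2 gb) gloop_classM !psi_push.
rewrite gloop_classM -psi_push; congr psi; apply/gloop_classP.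
apply: gloop_eq_homotopic => t /=; rewrite /concat_fun /=.
by case: ifP.
Qed.

(** Paths are homotopies of point loops, and [push] both preserves and reflects homotopy. *)
Lemma to_complex_path_component (y : Y) :
  to_complex @` path_component R y = path_component R (to_complex y).
Proof.
have pg z : push (point_gloop R (to_complex y) (to_complex z)) =1 point_gloop R y z.
  by move=> t /=; rewrite to_complexK.
have pgh z := gloop_eq_homotopic (pg z).
apply/seteqP; split=> [_ [z yz <-]|z' yz'].
  apply/(path_componentP R (to_complex y)); apply: push_injective.
  apply: gloop_homotopic_trans (pgh y) _.
  apply: gloop_homotopic_trans (gloop_homotopic_sym (pgh z)).
  exact/(path_componentP R y).
exists (to_thickening z'); last exact: to_thickeningK.
move: yz'; rewrite -{1}(to_thickeningK z') => /(path_componentP R (to_complex y)) yz.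
apply/(path_componentP R y).
apply: gloop_homotopic_trans (gloop_homotopic_sym (pgh y)) _.
by apply: gloop_homotopic_trans (pgh _); exact: push_homotopic.
Qed.

End HomotopyGroups.

Theorem theorem1 (R : realType) (X : metricType R) (I : Type) (U : I -> set X)
    (sepX : separable X) (openU : open_cover U) (bndU : uniformly_bounded U) :
  isomorphic_homotopy_groups R
    (vietoris_thickening U) (realization R (vietoris_complex U)).
Proof.
pose h := @to_complex R X I U.
have hK := @to_complexK R X I U; have Kh := @to_thickeningK R X I U.
have hinj := can_inj hK.
(* Direct image under the bijection [h] matches the path components, which gives the equality of
   cardinals and carries a transversal to a transversal. *)
have comp : @path_components R (realization R (vietoris_complex U)) =
    (fun C => h @` C) @` @path_components R (set_type (vietoris_thickening U)).
  apply/seteqP; split=> [_ [y' _ <-]|_ [_ [y _ <-] <-]].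
    exists (path_component R (to_thickening y')); first by exists (to_thickening y').
    by rewrite /h to_complex_path_component // Kh.
  by exists (h y) => //; rewrite /h to_complex_path_component.
have himg (C D : set (set_type (vietoris_thickening U))) : h @` C = h @` D -> C = D.
  move=> e; apply/seteqP; split=> y Cy.
    have : (h @` D) (h y) by rewrite -e; exists y.
    by move=> [z Dz /hinj <-].
  have : (h @` C) (h y) by rewrite e; exists y.
  by move=> [z Dz /hinj <-].
split.
  by rewrite comp card_eq_sym; apply: inj_card_eq => C D _ _; exact: himg.
have [S Str] := transversal_exists R (set_type (vietoris_thickening U)).
exists S, (h @` S), h; split=> //.
- rewrite /transversal_of_path_components comp => _ [C pC <-].
  have [y [[Sy Cy] yuniq]] := Str C pC.
  exists (h y); split; first by split; exists y.
  move=> _ [[z Sz <-] [w Cw wz]]; congr h; apply: yuniq; split=> //.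
  by rewrite -(hinj _ _ wz).
- apply: inj_bij; exact: in2W.
- by move=> y _ k; exact: to_complex_homotopy_group_iso.
Qed.
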